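(* Assume $\diamondsuit_{\aleph_1}$. If $M$ is a countable model of PA, then $M$ has an elementary extension $N$ of cardinality $\aleph_1$ such that $E^5_N = E^3_N$; that is, $N$ is 3-o.r.
   Context: All models are models of Peano Arithmetic (PA) in the vocabulary $\{0,1,<,+,\times\}$ which are ordinary, i.e. the standard natural numbers $\mathbb N$ form an initial segment of the model. For a model $N$ and $a\in N$, $N_{<a}=\{c\in N: c<_N a\}$ with the induced order. On $N\setminus\mathbb N$ define: $a\,E^3_N\,b$ iff there is $c\in N$ such that for every $n\in\mathbb N$ we have $c^n<_N a$ and $c^n<_N b$, and moreover $a<_N b\times_N c$ and $b<_N a\times_N c$. Define $a\,E^5_N\,b$ iff some automorphism of the linear order $(N,<_N)$ maps $a$ to $b$. $N$ is called 3-o.r. (order-rigid) if for all $a,b\in N\setminus\mathbb N$, $(N_{<a},<_N)\cong(N_{<b},<_N)$ implies $a\,E^3_N\,b$. *)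

(* Defs.v *)
From mathcomp Require Import all_boot.
From mathcomp Require Import boolp classical_sets functions cardinality.

Set Implicit Arguments.
Unset Strict Implicit.
Unset Printing Implicit Defensive.

Local Open Scope classical_set_scope.
Local Open Scope card_scope.

(* First-order logic with equality in the vocabulary {0, 1, <, +, *}.
   Variables are de Bruijn indices; the remaining connectives are derived
   classically from falsum, implication and universal quantification. *)

Inductive term : Type :=
| tVar of nat
| tZero
| tOne
| tAdd of term & term
| tMul of term & term.

Inductive formula : Type :=
| fFalse
| fEq of term & term
| fLt of term & term
| fImp of formula & formula
| fAll of formula.

Definition fNot (p : formula) : formula := fImp p fFalse.
Definition fAnd (p q : formula) : formula := fNot (fImp p (fNot q)).
Definition fIff (p q : formula) : formula := fAnd (fImp p q) (fImp q p).
Definition fEx (p : formula) : formula := fNot (fAll (fNot p)).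

Fixpoint tsubst (s : nat -> term) (t : term) : term :=
  match t with
  | tVar n => s n
  | tZero => tZero
  | tOne => tOne
  | tAdd t1 t2 => tAdd (tsubst s t1) (tsubst s t2)
  | tMul t1 t2 => tMul (tsubst s t1) (tsubst s t2)
  end.

Definition tshift (t : term) : term := tsubst (fun n => tVar n.+1) t.

Definition sub_up (s : nat -> term) (n : nat) : term :=
  if n is m.+1 then tshift (s m) else tVar 0.

Fixpoint fsubst (s : nat -> term) (p : formula) : formula :=
  match p with
  | fFalse => fFalse
  | fEq t1 t2 => fEq (tsubst s t1) (tsubst s t2)
  | fLt t1 t2 => fLt (tsubst s t1) (tsubst s t2)
  | fImp p1 p2 => fImp (fsubst s p1) (fsubst s p2)
  | fAll p1 => fAll (fsubst (sub_up s) p1)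
  end.

(* [sub0 t] replaces variable 0 by t, and lowers the other variables; [subS]
   replaces variable 0 by its successor, and keeps the other variables. *)
Definition sub0 (t : term) (n : nat) : term := if n is m.+1 then tVar m else t.
Definition subS (n : nat) : term :=
  if n is 0 then tAdd (tVar 0) tOne else tVar n.

Record structure := Structure {
  carrier :> Type;
  zero : carrier;
  one : carrier;
  lt : carrier -> carrier -> Prop;
  add : carrier -> carrier -> carrier;
  mul : carrier -> carrier -> carrier
}.

Definition env_cons (T : Type) (x : T) (e : nat -> T) (n : nat) : T :=
  if n is m.+1 then e m else x.

Fixpoint teval (M : structure) (e : nat -> M) (t : term) : M :=
  match t with
  | tVar n => e n
  | tZero => zero M
  | tOne => one M
  | tAdd t1 t2 => add (teval e t1) (teval e t2)
  | tMul t1 t2 => mul (teval e t1) (teval e t2)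
  end.

Fixpoint sat (M : structure) (e : nat -> M) (p : formula) : Prop :=
  match p with
  | fFalse => False
  | fEq t1 t2 => teval e t1 = teval e t2
  | fLt t1 t2 => lt (teval e t1) (teval e t2)
  | fImp p1 p2 => sat e p1 -> sat e p2
  | fAll p1 => forall x : M, sat (env_cons x e) p1
  end.

(* Axioms are understood through their universal closures, so the free
   variables of the induction formula act as parameters. *)
Inductive PA : formula -> Prop :=
| PA_succ_neq0 : PA (fNot (fEq (tAdd (tVar 0) tOne) tZero))
| PA_succ_inj :
    PA (fImp (fEq (tAdd (tVar 0) tOne) (tAdd (tVar 1) tOne))
             (fEq (tVar 0) (tVar 1)))
| PA_add0 : PA (fEq (tAdd (tVar 0) tZero) (tVar 0))
| PA_addS :
    PA (fEq (tAdd (tVar 0) (tAdd (tVar 1) tOne))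
            (tAdd (tAdd (tVar 0) (tVar 1)) tOne))
| PA_mul0 : PA (fEq (tMul (tVar 0) tZero) tZero)
| PA_mulS :
    PA (fEq (tMul (tVar 0) (tAdd (tVar 1) tOne))
            (tAdd (tMul (tVar 0) (tVar 1)) (tVar 0)))
| PA_lt :
    PA (fIff (fLt (tVar 0) (tVar 1))
             (fEx (fEq (tAdd (tVar 1) (tAdd (tVar 0) tOne)) (tVar 2))))
| PA_induction p :
    PA (fImp (fsubst (sub0 tZero) p)
             (fImp (fAll (fImp p (fsubst subS p))) (fAll p))).

Definition PA_model (M : structure) : Prop :=
  forall p, PA p -> forall e : nat -> M, sat e p.

Definition elementary_embedding (M N : structure) (h : M -> N) : Prop :=
  forall p (e : nat -> M), sat e p <-> sat (h \o e) p.

Fixpoint numeral (M : structure) (n : nat) : M :=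
  if n is m.+1 then add (numeral M m) (one M) else zero M.

Definition standard (M : structure) : set M := range (numeral M).

Definition ordinary (M : structure) : Prop :=
  (forall m n : nat, (m < n)%N <-> lt (numeral M m) (numeral M n)) /\
  (forall a b : M, standard b -> lt a b -> standard a).

Fixpoint power (M : structure) (c : M) (n : nat) : M :=
  if n is m.+1 then mul (power c m) c else one M.

Definition below (T : Type) (R : T -> T -> Prop) (a : T) : set T :=
  [set x | R x a].

Definition order_iso (N : structure) (A B : set N) (f : N -> N) : Prop :=
  set_bij A B f /\
  (forall x y, A x -> A y -> (lt x y <-> lt (f x) (f y))).

(* E3 and E5 are only meant for nonstandard arguments. *)
Definition E3 (N : structure) (a b : N) : Prop :=
  exists c : N,
    (forall n : nat, lt (power c n) a /\ lt (power c n) b) /\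
    lt a (mul b c) /\ lt b (mul a c).

Definition E5 (N : structure) (a b : N) : Prop :=
  exists f : N -> N, order_iso setT setT f /\ f a = b.

Definition order_rigid3 (N : structure) : Prop :=
  forall a b : N, ~ standard a -> ~ standard b ->
    (exists f : N -> N, order_iso (below (@lt N) a) (below (@lt N) b) f) ->
    E3 a b.

(* R is a strict well-order of type omega_1. *)
Definition omega1_order (W : Type) (R : W -> W -> Prop) : Prop :=
  [/\ well_founded R,
      (forall x y z, R x y -> R y z -> R x z),
      (forall x y, R x y \/ x = y \/ R y x),
      ~ countable [set: W] &
      (forall x, countable (below R x))].

Definition card_aleph1 (T : Type) : Prop :=
  exists (W : Type) (R : W -> W -> Prop),
    omega1_order R /\ [set: T] #= [set: W].

Section Diamond.
Variables (W : Type) (R : W -> W -> Prop).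

(* The hypotheses on d in [closed_in] say that d is a limit point of C. *)
Definition closed_in (C : set W) : Prop :=
  forall d, (exists x, R x d) ->
    (forall x, R x d -> exists y, [/\ C y, R x y & R y d]) -> C d.

Definition unbounded_in (C : set W) : Prop :=
  forall x, exists y, C y /\ R x y.

Definition stationary (S : set W) : Prop :=
  forall C, closed_in C -> unbounded_in C -> S `&` C !=set0.

Definition diamond_on : Prop :=
  exists A : W -> set W,
    (forall a, A a `<=` below R a) /\
    (forall X : set W, stationary [set a | X `&` below R a = A a]).

End Diamond.

(* Any two orders of type omega_1 are isomorphic, so the choice of R does not
   matter. *)
Definition diamond_aleph1 : Prop :=
  exists (W : Type) (R : W -> W -> Prop), omega1_order R /\ diamond_on R.

(* Main.v *)
Require Import Defs.
From HB Require Import structures.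
From Stdlib Require Import Inverse_Image.
From mathcomp Require Import all_boot all_order all_algebra ring lra.
From mathcomp Require Import boolp classical_sets functions cardinality filter.
Import Defs.

(** If [c] witnesses [E3 a b], let [I] be the cut of the elements below some
    standard power of [c].  Multiplication by [b / a] induces an automorphism of
    the order of the classes modulo [I], because [I] is closed under
    multiplication by [c]; translating every class rigidly along this map gives
    an automorphism of the order sending [a] to [b].

    For rigidity, [N] is the union of a chain of countable models indexed by
    omega_1.  Each one is a definable ultrapower of the union [K] of its
    predecessors, by a generic ultrafilter on the definable sets of [K].  Given an
    increasing map [F] of [[0, a]] into [[0, F a]] guessed by diamond, with
    [a < F a] and not [E3 a (F a)], the new element [y] is such that the cut
    [{x | F x < y}] is filled neither now nor later, so that [F] does not extend
    to an isomorphism onto the elements below [F a].  The conditions are the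
    definable sets [Y] contained in [[F d, F (d + s))] whose cardinality, computed
    in [K], is infinitely larger than [s * P], where [P] is nonstandard and
    [s <= P ^ k] with [k] standard.
    - A gap remains a gap: halve [Y] at the median of a definable function [g].
    - The cut of [y] is not filled by [g y]: either some [x] separates [g y] from
      it for many [y] in [Y], or [x |-> |{y in Y | g y <= x}|] is a definable
      approximation of the undefinable [x |-> |{y in Y | y < F x}|].  In the latter
      case the pigeonhole principle, which is not available for [F], applies to the
      approximation, and yields a subinterval of [[d, d + s)] of length about
      [s / P] with an almost unchanged ratio between the size of [Y] and the
      length.  As [s <= P ^ k], this happens at most [k] times. *)

Set Implicit Arguments.
Unset Strict Implicit.
Unset Printing Implicit Defensive.

Local Open Scope classical_set_scope.

(** * Countable sets *)

Lemma countable_image (T T' : Type) (f : T -> T') (A : set T) :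
  countable A -> countable [set f x | x in A].
Proof. exact: sub_countable (card_image_le f A). Qed.

Lemma countable_setU (T : Type) (A B : set T) :
  countable A -> countable B -> countable (A `|` B).
Proof.
move=> cA cB.
apply: (@sub_countable _ _ _ (\bigcup_(b in [set: bool]) if b then A else B)).
  by apply: subset_card_le => x [Ax|Bx]; [exists true|exists false].
by apply: bigcup_countable => // -[].
Qed.

(** * Formulas *)

Lemma teval_subst (K : structure) (e : nat -> K) s t :
  teval e (tsubst s t) = teval (fun n => teval e (s n)) t.
Proof. by elim: t => //= t1 -> t2 ->. Qed.

Lemma sat_subst (K : structure) p (e : nat -> K) s :
  sat e (fsubst s p) <-> sat (fun n => teval e (s n)) p.
Proof.
elim: p e s => [|t1 t2|t1 t2|p IHp q IHq|p IHp] e s //=; rewrite ?teval_subst //.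
  by split=> pq /IHp /pq /IHq.
have env_up x : (fun n => teval (env_cons x e) (sub_up s n)) =
                env_cons x (fun n => teval e (s n)).
  by apply/funext => -[|n] //=; rewrite /tshift teval_subst.
by split=> sat_p x; move: (sat_p x); rewrite IHp env_up.
Qed.

Definition rename (f : nat -> nat) (p : formula) : formula :=
  fsubst (fun i => tVar (f i)) p.

Lemma sat_rename (K : structure) p (e : nat -> K) f :
  sat e (rename f p) <-> sat (fun i => e (f i)) p.
Proof. exact: sat_subst. Qed.

Definition agree_below (T : Type) n (e e' : nat -> T) := forall i, i < n -> e i = e' i.

Lemma agree_below_max (T : Type) m n (e e' : nat -> T) :
  agree_below (maxn m n) e e' -> agree_below m e e' /\ agree_below n e e'.
Proof. by move=> ee'; split=> i i_lt; apply: ee'; rewrite leq_max i_lt ?orbT. Qed.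

Lemma teval_local t : exists n, forall (K : structure) (e e' : nat -> K),
  agree_below n e e' -> teval e t = teval e' t.
Proof.
elim: t => [i|||t1 [n1 loc1] t2 [n2 loc2]|t1 [n1 loc1] t2 [n2 loc2]].
- by exists i.+1 => K e e'; apply.
- by exists 0.
- by exists 0.
- by exists (maxn n1 n2) => K e e' /agree_below_max [/loc1 /= -> /loc2 ->].
- by exists (maxn n1 n2) => K e e' /agree_below_max [/loc1 /= -> /loc2 ->].
Qed.

Lemma teval2_local t1 t2 : exists n, forall (K : structure) (e e' : nat -> K),
  agree_below n e e' -> teval e t1 = teval e' t1 /\ teval e t2 = teval e' t2.
Proof.
have [n1 loc1] := teval_local t1; have [n2 loc2] := teval_local t2.
by exists (maxn n1 n2) => K e e' /agree_below_max [/loc1 -> /loc2 ->].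
Qed.

Lemma sat_local p : exists n, forall (K : structure) (e e' : nat -> K),
  agree_below n e e' -> (sat e p <-> sat e' p).
Proof.
elim: p => [|t1 t2|t1 t2|p [n1 loc1] q [n2 loc2]|p [n loc]].
- by exists 0.
- by have [n loc] := teval2_local t1 t2; exists n => K e e' /loc /= [-> ->].
- by have [n loc] := teval2_local t1 t2; exists n => K e e' /loc /= [-> ->].
- by exists (maxn n1 n2) => K e e' /agree_below_max [/loc1 /= -> /loc2 ->].
- exists n => K e e' ee' /=.
  have sat_cons x : sat (env_cons x e) p <-> sat (env_cons x e') p.
    by apply: loc => -[|i] //= i_n; apply: ee'; apply: ltnW.
  by split=> sat_p x; apply/sat_cons.
Qed.

Section FormulaCoding.
Import GenTree.

Fixpoint term_tree (t : term) : tree nat := match t with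
  | tVar n => Leaf n
  | tZero => Node 0 [::]
  | tOne => Node 1 [::]
  | tAdd t1 t2 => Node 2 [:: term_tree t1; term_tree t2]
  | tMul t1 t2 => Node 3 [:: term_tree t1; term_tree t2]
  end.

Fixpoint tree_term (u : tree nat) : term := match u with
  | Leaf n => tVar n
  | Node 1 _ => tOne
  | Node 2 [:: u1; u2] => tAdd (tree_term u1) (tree_term u2)
  | Node 3 [:: u1; u2] => tMul (tree_term u1) (tree_term u2)
  | _ => tZero
  end.

Lemma term_treeK : cancel term_tree tree_term.
Proof. by elim=> //= t1 -> t2 ->. Qed.

Fixpoint formula_tree (p : formula) : tree nat := match p with
  | fFalse => Node 0 [::]
  | fEq t1 t2 => Node 1 [:: term_tree t1; term_tree t2]
  | fLt t1 t2 => Node 2 [:: term_tree t1; term_tree t2]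
  | fImp p q => Node 3 [:: formula_tree p; formula_tree q]
  | fAll p => Node 4 [:: formula_tree p]
  end.

Fixpoint tree_formula (u : tree nat) : formula := match u with
  | Node 1 [:: u1; u2] => fEq (tree_term u1) (tree_term u2)
  | Node 2 [:: u1; u2] => fLt (tree_term u1) (tree_term u2)
  | Node 3 [:: u1; u2] => fImp (tree_formula u1) (tree_formula u2)
  | Node 4 [:: u1] => fAll (tree_formula u1)
  | _ => fFalse
  end.

Lemma formula_treeK : cancel formula_tree tree_formula.
Proof. by elim=> //= [t1 t2|t1 t2|p -> q ->|p ->] //; rewrite !term_treeK. Qed.

End FormulaCoding.

HB.instance Definition _ := Countable.copy formula (can_type formula_treeK).

(** * Definability with parameters *)

Section Definability.
Variable K : structure.
Implicit Types (S : (nat -> K) -> Prop) (t : (nat -> K) -> K).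

(* [s i = inl j] makes variable [i] stand for the argument [e j], and
   [s i = inr k] for the parameter [k]. *)
Definition valuation (s : nat -> nat + K) (e : nat -> K) (i : nat) : K :=
  match s i with inl j => e j | inr k => k end.

Definition definable S := exists p s, forall e, S e <-> sat (valuation s e) p.

Lemma definable_ext S S' : (forall e, S e <-> S' e) -> definable S -> definable S'.
Proof. by move=> SS' [p [s def]]; exists p, s => e; rewrite -SS'. Qed.

Lemma definable_sat_var (p : formula) (f : nat -> nat) :
  definable (fun e => sat (fun i => e (f i)) p).
Proof. by exists p, (fun i => inl (f i)). Qed.

Lemma definable_prop (P : Prop) : definable (fun=> P).
Proof.
have [HP|HP] := pselect P; last by exists fFalse, inl.
by exists (fNot fFalse), inl => e; split=> //= _.
Qed.

Lemma definable_imp S1 S2 :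
  definable S1 -> definable S2 -> definable (fun e => S1 e -> S2 e).
Proof.
move=> [p1 [s1 def1]] [p2 [s2 def2]].
exists (fImp (rename double p1) (rename (succn \o double) p2)),
  (fun i => if odd i then s2 i./2 else s1 i./2) => e /=.
rewrite def1 def2 !sat_rename /valuation.
have -> : (fun i => match if odd i.*2 then s2 i.*2./2 else s1 i.*2./2 with
                    | inl j => e j | inr k => k end) = valuation s1 e.
  by apply/funext => i; rewrite odd_double doubleK.
suff -> : (fun i => match if odd i.*2.+1 then s2 i.*2.+1./2 else s1 i.*2.+1./2 with
                    | inl j => e j | inr k => k end) = valuation s2 e by [].
by apply/funext => i; rewrite /= odd_double /= uphalf_double.
Qed.

Lemma definable_all (S : K -> (nat -> K) -> Prop) :
  definable (fun e => S (e 0) (fun i => e i.+1)) ->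
  definable (fun e => forall x, S x e).
Proof.
move=> [p [s def]].
pose bound i := if s i is inl 0 then true else false.
exists (fAll (rename (fun i => if bound i then 0 else i.+1) p)),
  (fun i => match s i with inl j => inl j.-1 | inr k => inr k end) => e /=.
have sat_x x : S x e <-> sat (valuation s (env_cons x e)) p.
  by rewrite -def.
have env_x x : (fun i => env_cons x (valuation
      (fun i => match s i with inl j => inl j.-1 | inr k => inr k end) e)
      (if bound i then 0 else i.+1)) = valuation s (env_cons x e).
  by apply/funext => i; rewrite /bound /valuation; case E: (s i) => [[|j]|k] /=;
    rewrite ?E.
by split=> all_S x; have := all_S x; rewrite sat_rename env_x sat_x.
Qed.

Lemma definable_rename f S : definable S -> definable (fun e => S (fun i => e (f i))).
Proof.
move=> [p [s def]].
exists p, (fun i => match s i with inl j => inl (f j) | inr k => inr k end) => e.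
rewrite def; suff -> : valuation s (fun i => e (f i)) = valuation
  (fun i => match s i with inl j => inl (f j) | inr k => inr k end) e by [].
by apply/funext => i; rewrite /valuation; case: (s i).
Qed.

Lemma definable_finite_parameters S : definable S ->
  exists p (l : seq (nat + K)), forall e, S e <-> sat (valuation (nth (inl 0) l) e) p.
Proof.
move=> [p [s def]]; have [n loc] := sat_local p.
exists p, (mkseq s n) => e; rewrite def; apply: loc => i i_n.
by rewrite /valuation nth_mkseq.
Qed.

Lemma definable_not S : definable S -> definable (fun e => ~ S e).
Proof. by move=> defS; apply: definable_imp => //; apply: definable_prop. Qed.

Lemma definable_or S1 S2 :
  definable S1 -> definable S2 -> definable (fun e => S1 e \/ S2 e).
Proof.
move=> def1 def2; apply: (@definable_ext (fun e => ~ S1 e -> S2 e)).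
  by move=> e; rewrite implyE notK.
by apply: definable_imp => //; apply: definable_not.
Qed.

Lemma definable_and S1 S2 :
  definable S1 -> definable S2 -> definable (fun e => S1 e /\ S2 e).
Proof.
move=> def1 def2; apply: (@definable_ext (fun e => ~ (S1 e -> ~ S2 e))).
  by move=> e; rewrite not_implyE notK.
by apply: definable_not; apply: definable_imp => //; apply: definable_not.
Qed.

Lemma definable_iff S1 S2 :
  definable S1 -> definable S2 -> definable (fun e => S1 e <-> S2 e).
Proof. by move=> def1 def2; apply: definable_and; apply: definable_imp. Qed.

Lemma definable_ex (S : K -> (nat -> K) -> Prop) :
  definable (fun e => S (e 0) (fun i => e i.+1)) ->
  definable (fun e => exists x, S x e).
Proof.
move=> defS; apply: (@definable_ext (fun e => ~ forall x, ~ S x e)).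
  move=> e; split=> [no|[x Sx] /(_ x)//].
  by apply: contrapT => /forallNP.
by apply: definable_not; apply: definable_all; apply: definable_not.
Qed.

Definition definable_term t := definable (fun e => e 0 = t (fun i => e i.+1)).
Definition definable1 (A : set K) := definable (fun e => A (e 0)).
Definition definable2 (A : K -> K -> Prop) := definable (fun e => A (e 0) (e 1)).
Definition definable3 (A : K -> K -> K -> Prop) :=
  definable (fun e => A (e 0) (e 1) (e 2)).
Definition definable_fun (f : K -> K) := definable_term (fun e => f (e 0)).
Definition definable_fun2 (f : K -> K -> K) :=
  definable_term (fun e => f (e 0) (e 1)).

Lemma definable_family (A : K -> (nat -> K) -> Prop) t f :
  definable (fun e => A (e 0) (fun i => e i.+1)) -> definable_term t ->
  definable (fun e => A (t e) (fun i => e (f i))).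
Proof.
move=> defA deft.
apply: (@definable_ext (fun e => exists x, x = t e /\ A x (fun i => e (f i)))).
  by move=> e; split=> [[_ [->]]//|At]; exists (t e).
apply: definable_ex; apply: definable_and => //.
exact: (definable_rename (fun i => if i is j.+1 then (f j).+1 else 0) defA).
Qed.

Lemma definable1_comp A t : definable1 A -> definable_term t ->
  definable (fun e => A (t e)).
Proof. by move=> defA; apply: (definable_family (A := fun x _ => A x) id defA). Qed.

Lemma definable_term_tail t :
  definable_term t -> definable_term (fun e => t (fun i => e i.+1)).
Proof. exact: (definable_rename (fun i => if i is j.+1 then j.+2 else 0)). Qed.

Lemma definable2_comp A t1 t2 : definable2 A ->
  definable_term t1 -> definable_term t2 -> definable (fun e => A (t1 e) (t2 e)).
Proof.
move=> defA def1 def2.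
apply: (definable_family (A := fun y e => A (t1 e) y) id _ def2).
exact: (definable_family (A := fun x e => A x (e 0)) id defA
  (definable_term_tail def1)).
Qed.

Lemma definable3_comp A t1 t2 t3 : definable3 A ->
  definable_term t1 -> definable_term t2 -> definable_term t3 ->
  definable (fun e => A (t1 e) (t2 e) (t3 e)).
Proof.
move=> defA def1 def2 def3.
apply: (definable_family (A := fun z e => A (t1 e) (t2 e) z) id _ def3).
apply: (definable_family (A := fun y e => A (t1 (fun i => e i.+1)) y (e 0)) id _
  (definable_term_tail def2)).
exact: (definable_family (A := fun x e => A x (e 0) (e 1)) id defA
  (definable_term_tail (definable_term_tail def1))).
Qed.

Lemma definable_term_const k : definable_term (fun=> k).
Proof.
by exists (fEq (tVar 0) (tVar 1)), (fun i => if i is 0 then inl 0 else inr k).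
Qed.

Lemma definable_term_var i : definable_term (fun e => e i).
Proof. exact: (definable_sat_var (fEq (tVar 0) (tVar i.+1)) id). Qed.

Lemma definable_eq t1 t2 : definable_term t1 -> definable_term t2 ->
  definable (fun e => t1 e = t2 e).
Proof.
apply: (definable2_comp (A := fun x y => x = y)).
exact: (definable_sat_var (fEq (tVar 0) (tVar 1)) id).
Qed.

Lemma definable_lt t1 t2 : definable_term t1 -> definable_term t2 ->
  definable (fun e => lt (t1 e) (t2 e)).
Proof.
apply: (definable2_comp (A := fun x y => lt x y)).
exact: (definable_sat_var (fLt (tVar 0) (tVar 1)) id).
Qed.

Lemma definable_term_comp1 f t :
  definable_fun f -> definable_term t -> definable_term (fun e => f (t e)).
Proof.
move=> deff deft; apply: (definable2_comp (A := fun x y => x = f y)) => //.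
  exact: definable_term_var 0.
exact: definable_term_tail.
Qed.

Lemma definable_term_comp2 (f : K -> K -> K) t1 t2 : definable_fun2 f ->
  definable_term t1 -> definable_term t2 -> definable_term (fun e => f (t1 e) (t2 e)).
Proof.
move=> deff def1 def2.
apply: (definable3_comp (A := fun x y z => x = f y z)) => //.
- exact: definable_term_var 0.
- exact: definable_term_tail.
- exact: definable_term_tail.
Qed.

Lemma definable_term_add t1 t2 : definable_term t1 -> definable_term t2 ->
  definable_term (fun e => add (t1 e) (t2 e)).
Proof.
apply: definable_term_comp2.
exact: (definable_sat_var (fEq (tVar 0) (tAdd (tVar 1) (tVar 2))) id).
Qed.

Lemma definable_term_mul t1 t2 : definable_term t1 -> definable_term t2 ->
  definable_term (fun e => mul (t1 e) (t2 e)).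
Proof.
apply: definable_term_comp2.
exact: (definable_sat_var (fEq (tVar 0) (tMul (tVar 1) (tVar 2))) id).
Qed.

Lemma definable_term_if (P : (nat -> K) -> Prop) t1 t2 :
  definable P -> definable_term t1 -> definable_term t2 ->
  definable_term (fun e => if `[< P e >] then t1 e else t2 e).
Proof.
move=> defP def1 def2; pose P' e := P (fun i => e i.+1).
apply: (@definable_ext (fun e => (P' e /\ e 0 = t1 (fun i => e i.+1)) \/
                                 (~ P' e /\ e 0 = t2 (fun i => e i.+1)))) => [e|].
  have [Pe|nPe] := pselect (P' e).
    by rewrite asboolT //; split=> [[[]|[]]//|e0]; left.
  by rewrite asboolF //; split=> [[[]|[]]//|e0]; right.
have defP' : definable P' by exact: definable_rename.
by apply: definable_or; apply: definable_and => //; apply: definable_not.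
Qed.

End Definability.

(* To be extended with the operations and relations shown definable later. *)
Ltac definable_hook := fail.

Ltac definable_step :=
  cbn beta delta [mkset setI setU setC setT set0];
  first [ definable_hook | match goal with
  | |- definable_term _ => first
    [ assumption
    | apply definable_term_const | apply definable_term_var
    | apply definable_term_add | apply definable_term_mul
    | match goal with H : definable_fun _ |- _ => apply (definable_term_comp1 H) end
    | match goal with H : definable_fun2 _ |- _ => apply (definable_term_comp2 H) end
    | apply definable_term_if
    | apply definable_term_tail; assumption ]
  | |- definable _ => first
    [ assumption
    | apply definable_prop
    | match goal with H : definable1 _ |- _ => apply (definable1_comp H) end
    | match goal with H : definable2 _ |- _ => apply (definable2_comp H) end
    | match goal with H : definable3 _ |- _ => apply (definable3_comp H) end
    | apply definable_and | apply definable_or | apply definable_iff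
    | apply definable_imp | apply definable_not | apply definable_eq
    | apply definable_lt | apply definable_ex | apply definable_all ]
  end ].

Ltac solve_definable := match goal with
  | |- definable1 _ => rewrite /definable1
  | |- definable2 _ => rewrite /definable2
  | |- definable3 _ => rewrite /definable3
  | |- definable_fun _ => rewrite /definable_fun
  | |- definable_fun2 _ => rewrite /definable_fun2
  | _ => idtac end; solve [repeat definable_step].

Lemma definable_sat (K : structure) p (T : nat -> (nat -> K) -> K) :
  (forall i, definable_term (T i)) -> definable (fun e => sat (fun i => T i e) p).
Proof.
have teval_def t (T' : nat -> (nat -> K) -> K) : (forall i, definable_term (T' i)) ->
    definable_term (fun e => teval (fun i => T' i e) t).
  move=> defT; elim: t => [n|||t1 ? t2 ?|t1 ? t2 ?] /=; first exact: defT.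
  - exact: definable_term_const.
  - exact: definable_term_const.
  - exact: definable_term_add.
  - exact: definable_term_mul.
elim: p T => [|t1 t2|t1 t2|p IHp q IHq|p IHp] T defT /=.
- exact: definable_prop.
- by apply: definable_eq; apply: teval_def.
- by apply: definable_lt; apply: teval_def.
- by apply: definable_imp; [apply: IHp|apply: IHq].
apply: definable_all.
apply: (definable_ext (S := fun e => sat (fun i =>
  if i is j.+1 then T j (fun i => e i.+1) else e 0) p)) => [e|].
  by rewrite (_ : (fun i => _) = env_cons (e 0) (fun j => T j (fun i => e i.+1))) //;
    apply/funext => -[].
apply: (IHp (fun i e => if i is j.+1 then T j (fun i => e i.+1) else e 0)).
by case=> [|i]; [exact: definable_term_var|exact: definable_term_tail].
Qed.

Lemma definable_subst (K : structure) (S : (nat -> K) -> Prop)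
    (T : nat -> (nat -> K) -> K) :
  definable S -> (forall i, definable_term (T i)) ->
  definable (fun e => S (fun i => T i e)).
Proof.
move=> [p [s def]] defT; pose T' i e := match s i with inl j => T j e | inr k => k end.
apply: (definable_ext (S := fun e => sat (fun i => T' i e) p)) => [e|].
  exact: iff_sym (def _).
apply: definable_sat => i; rewrite /T'; case: (s i) => [j|k]; first exact: defT.
exact: definable_term_const.
Qed.

Lemma countable_definable_fun (K : structure) :
  countable [set: K] -> countable [set g : K -> K | definable_fun g].
Proof.
move=> /countable_injP [c c_inj].
have /choice [code codeP] (g : K -> K) : exists pl : formula * seq (nat + K),
    definable_fun g -> forall e, e 0 = g (e 1) <->
      sat (valuation (nth (inl 0) pl.2) e) pl.1.
  have [/definable_finite_parameters [p [l def]]|ng] := pselect (definable_fun g).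
    by exists (p, l).
  by exists (fFalse, [::]).
pose enc (u : nat + K) : nat + nat :=
  match u with inl i => inl i | inr k => inr (c k) end.
have enc_inj : injective enc.
  by move=> [i|k] [j|l] //= [] => [->//|/c_inj ->//]; rewrite inE.
apply/countable_injP; exists (fun g => pickle ((code g).1, map enc (code g).2)).
move=> g h; rewrite !inE /= => def_g def_h.
move=> /(pcan_inj pickleK) [Ep /(inj_map enc_inj) El].
apply/funext => x; pose e i := if i is 0 then h x else x.
apply/esym; have /codeP /(_ e) /= := def_g; rewrite Ep El => ->.
by have /codeP /(_ e) /= <- := def_h.
Qed.

(** * The ordered ring of differences of a semiring *)

Section DifferenceRing.
Import GRing.Theory Quotient.
Local Open Scope ring_scope.
Local Open Scope quotient_scope.
Variable R : comNzSemiRingType.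
Implicit Types p q : R * R.

(* These properties say that [R] is the set of nonnegative elements of a totally
   ordered integral domain, which the difference ring then is. *)
Record positive_cone : Prop := PositiveCone {
  cone_addIr : forall z : R, injective (+%R^~ z);
  cone_total : forall x y : R, exists z, x + z = y \/ y + z = x;
  cone_add_eq0 : forall x y : R, x + y = 0 -> x = 0;
  cone_mul_eq0 : forall x y : R, x * y = 0 -> x = 0 \/ y = 0 }.

Hypothesis cone : positive_cone.

Definition same_diff p q := p.1 + q.2 == q.1 + p.2.

Lemma same_diff_refl : reflexive same_diff.
Proof. by move=> p; rewrite /same_diff. Qed.

Lemma same_diff_sym : symmetric same_diff.
Proof. by move=> p q; rewrite /same_diff eq_sym. Qed.

Lemma same_diff_trans : transitive same_diff.
Proof.
move=> q p r; rewrite /same_diff => /eqP pq /eqP qr.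
apply/eqP/(cone_addIr cone (z := q.1 + q.2)).
have -> : p.1 + r.2 + (q.1 + q.2) = (p.1 + q.2) + (q.1 + r.2) by ring.
by rewrite pq qr; ring.
Qed.

Canonical same_diff_equiv :=
  EquivRel same_diff same_diff_refl same_diff_sym same_diff_trans.

Definition diffring : Type := {eq_quot same_diff}.
HB.instance Definition _ : EqQuotient _ same_diff diffring := EqQuotient.on diffring.
HB.instance Definition _ := Choice.on diffring.

Definition diff p : diffring := \pi p.

Lemma diff_eqP p q : reflect (p.1 + q.2 = q.1 + p.2) (diff p == diff q).
Proof. by rewrite eqmodE; apply: eqP. Qed.

Lemma diff_surj (u : diffring) : exists p, u = diff p.
Proof. by exists (repr u); rewrite /diff reprK. Qed.

Lemma repr_diff p : (repr (diff p)).1 + p.2 = p.1 + (repr (diff p)).2.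
Proof. by apply/diff_eqP; rewrite {1}/diff reprK. Qed.

Definition diff_add (u v : diffring) : diffring :=
  diff ((repr u).1 + (repr v).1, (repr u).2 + (repr v).2).
Definition diff_opp (u : diffring) : diffring := diff ((repr u).2, (repr u).1).
Definition diff_mul (u v : diffring) : diffring :=
  diff ((repr u).1 * (repr v).1 + (repr u).2 * (repr v).2,
        (repr u).1 * (repr v).2 + (repr u).2 * (repr v).1).

Lemma diff_addE p q : diff_add (diff p) (diff q) = diff (p.1 + q.1, p.2 + q.2).
Proof.
apply/eqP/diff_eqP => /=; move: (repr_diff p) (repr_diff q).
move: (repr (diff p)) (repr (diff q)) => p' q' pE qE.
have -> : p'.1 + q'.1 + (p.2 + q.2) = (p'.1 + p.2) + (q'.1 + q.2) by ring.
by rewrite pE qE; ring.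
Qed.

Lemma diff_oppE p : diff_opp (diff p) = diff (p.2, p.1).
Proof.
apply/eqP/diff_eqP => /=; move: (repr_diff p); move: (repr _) => p' pE.
by rewrite addrC -pE addrC.
Qed.

Lemma diff_mulE p q :
  diff_mul (diff p) (diff q) = diff (p.1 * q.1 + p.2 * q.2, p.1 * q.2 + p.2 * q.1).
Proof.
apply/eqP/diff_eqP => /=; move: (repr_diff p) (repr_diff q).
move: (repr (diff p)) (repr (diff q)) => p' q' pE qE.
apply: (cone_addIr cone (z := p.1 * q'.2 + p.2 * q'.1)).
have -> : p'.1 * q'.1 + p'.2 * q'.2 + (p.1 * q.2 + p.2 * q.1) +
  (p.1 * q'.2 + p.2 * q'.1) =
  (p'.1 + p.2) * q'.1 + (p.1 + p'.2) * q'.2 + (p.1 * q.2 + p.2 * q.1) by ring.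
rewrite pE -{2}pE.
have -> : (p.1 + p'.2) * q'.1 + (p'.1 + p.2) * q'.2 + (p.1 * q.2 + p.2 * q.1) =
  p.1 * (q'.1 + q.2) + p.2 * (q.1 + q'.2) + (p'.1 * q'.2 + p'.2 * q'.1) by ring.
by rewrite qE -{2}qE; ring.
Qed.

Definition diff_of (x : R) : diffring := diff (x, 0).

Ltac diff_ring := repeat match goal with u : diffring |- _ =>
    let p := fresh "p" in have [p ->] := diff_surj u; clear u end;
  rewrite /diff_of ?(diff_addE, diff_mulE, diff_oppE); apply/eqP/diff_eqP => /=; ring.

Lemma diff_addA : associative diff_add. Proof. by move=> u v w; diff_ring. Qed.
Lemma diff_addC : commutative diff_add. Proof. by move=> u v; diff_ring. Qed.
Lemma diff_add0 : left_id (diff_of 0) diff_add. Proof. by move=> u; diff_ring. Qed.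
Lemma diff_addN : left_inverse (diff_of 0) diff_opp diff_add.
Proof. by move=> u; diff_ring. Qed.
Lemma diff_mulA : associative diff_mul. Proof. by move=> u v w; diff_ring. Qed.
Lemma diff_mulC : commutative diff_mul. Proof. by move=> u v; diff_ring. Qed.
Lemma diff_mul1 : left_id (diff_of 1) diff_mul. Proof. by move=> u; diff_ring. Qed.
Lemma diff_mulDl : left_distributive diff_mul diff_add.
Proof. by move=> u v w; diff_ring. Qed.

Lemma diff_of_inj : injective diff_of.
Proof. by move=> x y /eqP/diff_eqP /=; rewrite !addr0. Qed.

Lemma diff_of1_neq0 : diff_of 1 != diff_of 0.
Proof. by rewrite (inj_eq diff_of_inj) oner_eq0. Qed.

HB.instance Definition _ :=
  GRing.isZmodule.Build diffring diff_addA diff_addC diff_add0 diff_addN.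
HB.instance Definition _ := GRing.Zmodule_isComNzRing.Build diffring
  diff_mulA diff_mulC diff_mul1 diff_mulDl diff_of1_neq0.

Lemma diff_ofD x y : diff_of (x + y) = diff_of x + diff_of y.
Proof. by rewrite [RHS]diff_addE addr0. Qed.

Lemma diff_ofM x y : diff_of (x * y) = diff_of x * diff_of y.
Proof. by rewrite [RHS]diff_mulE /= !(mulr0, mul0r, addr0). Qed.

Lemma diffring_cases (u : diffring) : exists x, u = diff_of x \/ u = - diff_of x.
Proof.
have [p ->] := diff_surj u; have [z [pz|pz]] := cone_total cone p.1 p.2; exists z.
  by right; rewrite [RHS]diff_oppE; apply/eqP/diff_eqP; rewrite /= add0r.
by left; apply/eqP/diff_eqP; rewrite /= addr0 -pz addrC.
Qed.

Definition diff_unit : {pred diffring} := fun u => `[< exists v, v * u = 1 >].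
Definition diff_inv (u : diffring) : diffring :=
  if pselect (exists v, v * u = 1) is left ex then projT1 (cid ex) else u.

Lemma diff_mulV : {in diff_unit, left_inverse 1 diff_inv *%R}.
Proof.
move=> u /asboolP unit_u; rewrite /diff_inv; case: pselect => // ex.
by case: (cid ex).
Qed.

Lemma diff_unitPl (u v : diffring) : v * u = 1 -> diff_unit u.
Proof. by move=> uv; apply/asboolP; exists v. Qed.

Lemma diff_inv_out : {in [predC diff_unit], diff_inv =1 id}.
Proof.
move=> u /negP nunit; rewrite /diff_inv; case: pselect => // ex.
by case: nunit; apply/asboolP.
Qed.

HB.instance Definition _ :=
  GRing.ComNzRing_hasMulInverse.Build diffring diff_mulV diff_unitPl diff_inv_out.

Lemma diffring_integral : GRing.integral_domain_axiom diffring.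
Proof.
have integral_of x y : diff_of x * diff_of y = 0 ->
  (diff_of x == 0) || (diff_of y == 0).
  by rewrite -diff_ofM => /diff_of_inj /(cone_mul_eq0 cone) [] ->; rewrite eqxx ?orbT.
move=> u v; have [x xE] := diffring_cases u; have [y yE] := diffring_cases v.
have [-> ->] : (u == 0) = (diff_of x == 0) /\ (v == 0) = (diff_of y == 0).
  by split; [case: xE|case: yE] => ->; rewrite ?oppr_eq0.
move=> /eqP uv0; apply/integral_of/eqP; move: uv0.
by case: xE => ->; case: yE => ->; rewrite ?(mulNr, mulrN, opprK, oppr_eq0).
Qed.

HB.instance Definition _ :=
  GRing.ComUnitRing_isIntegral.Build diffring diffring_integral.

Definition diff_nonneg (u : diffring) : bool := `[< exists x, u = diff_of x >].
Definition diff_le (u v : diffring) : bool := diff_nonneg (v - u).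
Definition diff_lt (u v : diffring) : bool := (v != u) && diff_le u v.
Definition diff_norm (u : diffring) : diffring := if diff_nonneg u then u else - u.

Lemma diff_nonnegP u : reflect (exists x, u = diff_of x) (diff_nonneg u).
Proof. exact: asboolP. Qed.

Lemma diff_nonneg_of x : diff_nonneg (diff_of x).
Proof. by apply/diff_nonnegP; exists x. Qed.

Lemma diff_le0 u : diff_le 0 u = diff_nonneg u.
Proof. by rewrite /diff_le subr0. Qed.

Lemma diff_le0_add u v : diff_le 0 u -> diff_le 0 v -> diff_le 0 (u + v).
Proof.
by rewrite !diff_le0 => /diff_nonnegP [x ->] /diff_nonnegP [y ->]; rewrite -diff_ofD
  diff_nonneg_of.
Qed.

Lemma diff_le0_mul u v : diff_le 0 u -> diff_le 0 v -> diff_le 0 (u * v).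
Proof.
by rewrite !diff_le0 => /diff_nonnegP [x ->] /diff_nonnegP [y ->]; rewrite -diff_ofM
  diff_nonneg_of.
Qed.

Lemma diff_le0_anti u : diff_le 0 u -> diff_le u 0 -> u = 0.
Proof.
rewrite diff_le0 /diff_le sub0r => /diff_nonnegP [x ->] /diff_nonnegP [y xy].
congr diff_of; apply: (cone_add_eq0 cone (y := y)); apply: diff_of_inj.
by rewrite diff_ofD -xy addrN.
Qed.

Lemma diff_sub_ge0 u v : diff_le 0 (v - u) = diff_le u v.
Proof. exact: diff_le0. Qed.

Lemma diff_le0_total u : diff_le 0 u || diff_le u 0.
Proof.
rewrite diff_le0 /diff_le sub0r.
by have [x [->|->]] := diffring_cases u; rewrite ?opprK diff_nonneg_of ?orbT.
Qed.

Lemma diff_normN u : diff_norm (- u) = diff_norm u.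
Proof.
rewrite /diff_norm; have := diff_le0_total u; rewrite diff_le0 {1}/diff_le sub0r.
have zero_of : diff_nonneg u -> diff_nonneg (- u) -> u = 0.
  by move=> u_ge Nu_ge; apply: diff_le0_anti; rewrite ?diff_le0 // /diff_le sub0r.
case: (boolP (diff_nonneg u)) => u_ge /=;
  case: (boolP (diff_nonneg (- u))) => Nu_ge //= _.
  by rewrite zero_of ?oppr0.
by rewrite opprK.
Qed.

Lemma diff_ge0_norm u : diff_le 0 u -> diff_norm u = u.
Proof. by rewrite diff_le0 /diff_norm => ->. Qed.

Lemma diff_lt_def u v : diff_lt u v = (v != u) && diff_le u v. Proof. by []. Qed.

HB.instance Definition _ := Num.IntegralDomain_isLeReal.Build diffring
  diff_le0_add diff_le0_mul diff_le0_anti diff_sub_ge0 diff_le0_total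
  diff_normN diff_ge0_norm diff_lt_def.

Lemma diff_of_le x y : (diff_of x <= diff_of y) <-> exists z, x + z = y.
Proof.
split=> [/diff_nonnegP [z /eqP]|[z <-]]; last first.
  by apply/diff_nonnegP; exists z; rewrite diff_ofD addrC addKr.
rewrite subr_eq -diff_ofD => /eqP/diff_of_inj ->.
by exists z; rewrite addrC.
Qed.

Lemma diff_of_ge0 x : 0 <= diff_of x.
Proof. by apply/(diff_of_le 0 x); exists x; rewrite add0r. Qed.

End DifferenceRing.

(** * Arithmetic in a model of Peano arithmetic *)

Definition le (K : structure) (x y : K) : Prop := exists z, add x z = y.

Declare Scope model_scope.
Delimit Scope model_scope with M.
Local Notation "0" := (zero _) : model_scope.
Local Notation "1" := (one _) : model_scope.
Local Notation "x + y" := (add x y) : model_scope.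
Local Notation "x * y" := (mul x y) : model_scope.
Local Notation "x < y" := (lt x y) : model_scope.
Local Notation "x <= y" := (le x y) : model_scope.
Local Notation "x ^ n" := (power x n%N) : model_scope.
Local Notation "n %:R" := (numeral _ n%N) : model_scope.
Local Notation "x <= y <= z" := ((x <= y)%M /\ (y <= z)%M) : model_scope.
Local Notation "x <= y < z" := ((x <= y)%M /\ (y < z)%M) : model_scope.

Record peano := Peano {
  peano_structure :> structure;
  peano_axioms : PA_model peano_structure }.

Section PeanoAxioms.
Local Open Scope model_scope.
Context {K : peano}.
Implicit Types x y z : K.

Lemma pa_ind (A : set K) :
  definable1 A -> A 0 -> (forall x, A x -> A (x + 1)) -> forall x, A x.
Proof.
move=> [p [s def]] A0 AS x.
pose q := rename (fun i => if s i is inl _ then 0%N else i.+1) p.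
pose r i := if s i is inr k then k else 0.
have sat_q y : sat (env_cons y r) q <-> A y.
  rewrite /q sat_rename; have /= -> := def (fun=> y).
  suff -> : (fun i => env_cons y r (if s i is inl _ then 0%N else i.+1)) =
            valuation s (fun=> y) by [].
  by apply/funext => i; rewrite /valuation /=; case E: (s i); rewrite /= /r ?E.
have := peano_axioms (PA_induction q) r; rewrite /= sat_subst.
have -> : (fun n => teval r (sub0 tZero n)) = env_cons 0 r by apply/funext => -[].
move=> /(_ (iffRL (sat_q _) A0)) ind_q; apply/(sat_q x)/ind_q => y; rewrite sat_subst.
have -> : (fun n => teval (env_cons y r) (subS n)) = env_cons (y + 1) r.
  by apply/funext => -[].
by rewrite !sat_q //; apply: AS.
Qed.

Lemma pa_succ_neq0 x : x + 1 <> 0.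
Proof. exact: (peano_axioms PA_succ_neq0 (nth 0 [:: x; x])). Qed.

Lemma pa_succ_inj x y : x + 1 = y + 1 -> x = y.
Proof. exact: (peano_axioms PA_succ_inj (nth 0 [:: x; y])). Qed.

Lemma pa_addr0 x : x + 0 = x.
Proof. exact: (peano_axioms PA_add0 (nth 0 [:: x; x])). Qed.

Lemma pa_addrS x y : x + (y + 1) = x + y + 1.
Proof. exact: (peano_axioms PA_addS (nth 0 [:: x; y])). Qed.

Lemma pa_mulr0 x : x * 0 = 0.
Proof. exact: (peano_axioms PA_mul0 (nth 0 [:: x; x])). Qed.

Lemma pa_mulrS x y : x * (y + 1) = x * y + x.
Proof. exact: (peano_axioms PA_mulS (nth 0 [:: x; y])). Qed.

Lemma pa_ltP x y : x < y <-> exists z, x + (z + 1) = y.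
Proof.
have := peano_axioms PA_lt (nth 0 [:: x; y]);
  rewrite /fIff /fAnd /fNot /fEx /= => pa_lt.
split=> [xy|[z xz]]; apply: contrapT => no; apply: pa_lt => xy_ex ex_xy.
  by apply: (xy_ex xy) => z xz; apply: no; exists z.
by apply/no/ex_xy => /(_ z).
Qed.

Lemma pa_add0r x : 0 + x = x.
Proof.
move: x; apply: pa_ind => [||x]; [by solve_definable|exact: pa_addr0|].
by rewrite pa_addrS => ->.
Qed.

Lemma pa_addSr x y : x + 1 + y = x + y + 1.
Proof.
move: y; apply: pa_ind => [||y]; [by solve_definable|by rewrite !pa_addr0|].
by rewrite !pa_addrS => ->.
Qed.

Lemma pa_addC x y : x + y = y + x.
Proof.
move: y; apply: pa_ind => [||y]; [by solve_definable|by rewrite pa_addr0 pa_add0r|].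
by rewrite pa_addrS pa_addSr => ->.
Qed.

Lemma pa_addA x y z : x + (y + z) = x + y + z.
Proof.
move: z; apply: pa_ind => [||z]; [by solve_definable|by rewrite !pa_addr0|].
by rewrite !pa_addrS => ->.
Qed.

Lemma pa_addIr z : injective (fun x => x + z).
Proof.
move=> x y; move: z; apply: pa_ind => [||z]; [by solve_definable|by rewrite !pa_addr0|].
by move=> IH; rewrite !pa_addrS => /pa_succ_inj.
Qed.

Lemma pa_mul0r x : 0 * x = 0.
Proof.
move: x; apply: pa_ind => [||x]; [by solve_definable|exact: pa_mulr0|].
by rewrite pa_mulrS pa_addr0.
Qed.

Lemma pa_mulSr x y : (x + 1) * y = x * y + y.
Proof.
move: y; apply: pa_ind => [||y IH]; [by solve_definable|by rewrite !pa_mulr0 pa_addr0|].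
rewrite !pa_mulrS IH !pa_addrS; congr add.
by rewrite -!pa_addA (pa_addC y x).
Qed.

Lemma pa_mulC x y : x * y = y * x.
Proof.
move: y; apply: pa_ind => [||y]; [by solve_definable|by rewrite pa_mulr0 pa_mul0r|].
by rewrite pa_mulrS pa_mulSr => ->.
Qed.

Lemma pa_mulDl x y z : (x + y) * z = x * z + y * z.
Proof.
move: z; apply: pa_ind => [||z IH]; [by solve_definable|by rewrite !pa_mulr0 pa_addr0|].
rewrite !pa_mulrS IH -!pa_addA; congr add.
by rewrite pa_addC -pa_addA (pa_addC y).
Qed.

Lemma pa_mulA x y z : x * (y * z) = x * y * z.
Proof.
move: z; apply: pa_ind => [||z IH]; [by solve_definable|by rewrite !pa_mulr0|].
by rewrite !pa_mulrS pa_mulC pa_mulDl -IH (pa_mulC x y) (pa_mulC x (_ * _)).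
Qed.

Lemma pa_mul1r x : 1 * x = x.
Proof. by rewrite -[1]pa_add0r pa_mulSr pa_mul0r pa_add0r. Qed.

Lemma pa_cases x : x = 0 \/ exists y, x = y + 1.
Proof.
by move: x; apply: pa_ind => [||x _]; [solve_definable|left|right; exists x].
Qed.

Lemma pa_add_eq0 x y : x + y = 0 -> x = 0.
Proof.
case: (pa_cases y) => [->|[z ->]]; first by rewrite pa_addr0.
by rewrite pa_addrS => /pa_succ_neq0.
Qed.

Lemma pa_mul_eq0 x y : x * y = 0 -> x = 0 \/ y = 0.
Proof.
case: (pa_cases x) => [->|[x' ->]]; first by left.
case: (pa_cases y) => [->|[y' ->]]; first by right.
by rewrite pa_mulrS pa_addrS => /pa_succ_neq0.
Qed.

Lemma pa_sub_total x y : exists z, x + z = y \/ y + z = x.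
Proof.
move: x; apply: pa_ind => [||x [z [<-|<-]]]; first by solve_definable.
- by exists y; left; rewrite pa_add0r.
- case: (pa_cases z) => [->|[z' ->]].
    by exists 1; right; rewrite pa_addr0.
  by exists z'; left; rewrite pa_addrS pa_addSr.
- by exists (z + 1); right; rewrite pa_addA.
Qed.

End PeanoAxioms.

Section PeanoSemiring.
Variable K : peano.

Definition semiring_of (K : peano) : Type := K.

HB.instance Definition _ := gen_eqMixin (semiring_of K).
HB.instance Definition _ := gen_choiceMixin (semiring_of K).

Lemma semiring_one_neq0 : (one K : semiring_of K) != zero K.
Proof. by apply/eqP => one0; apply: (@pa_succ_neq0 K (zero K)); rewrite pa_add0r. Qed.

HB.instance Definition _ := GRing.isNmodule.Build (semiring_of K)
  (pa_addA : associative (@add K)) pa_addC pa_add0r.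
HB.instance Definition _ := GRing.Nmodule_isComNzSemiRing.Build (semiring_of K)
  (pa_mulA : associative (@mul K)) pa_mulC pa_mul1r pa_mulDl pa_mul0r semiring_one_neq0.

Lemma pa_cone : positive_cone (semiring_of K).
Proof.
split; [exact: pa_addIr|exact: pa_sub_total|exact: pa_add_eq0|exact: pa_mul_eq0].
Qed.

End PeanoSemiring.

(* [lra] and [nra] apply to ordered rings only, hence the detour of [pa_lra] and
   [pa_nra] through the ring of differences. *)
Section Transfer.
Import Order.TTheory GRing.Theory Num.Theory.
Local Open Scope ring_scope.
Context {K : peano}.
Implicit Types x y : K.

Definition to_diff x : diffring (pa_cone K) := diff_of (pa_cone K) x.

Lemma to_diff0 : to_diff (zero K) = 0. Proof. by []. Qed.
Lemma to_diff1 : to_diff (one K) = 1. Proof. by []. Qed.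

Lemma to_diffD x y : to_diff (add x y) = to_diff x + to_diff y.
Proof. exact: diff_ofD. Qed.

Lemma to_diffM x y : to_diff (mul x y) = to_diff x * to_diff y.
Proof. exact: diff_ofM. Qed.

Lemma to_diff_numeral n : to_diff (numeral K n) = n%:R.
Proof. by elim: n => // n IH; rewrite to_diffD IH -natr1. Qed.

Lemma to_diffX x n : to_diff (power x n) = to_diff x ^+ n.
Proof. by elim: n => // n IH; rewrite to_diffM IH exprSr. Qed.

Definition to_diffE :=
  (to_diff0, to_diff1, to_diffD, to_diffM).

Lemma to_diff_inj : injective to_diff.
Proof. exact: diff_of_inj. Qed.

Lemma to_diff_ge0 x : 0 <= to_diff x.
Proof. exact: diff_of_ge0. Qed.

Lemma to_diff_le x y : le x y <-> to_diff x <= to_diff y.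
Proof. by rewrite diff_of_le. Qed.

Lemma to_diff_lt x y : lt x y <-> to_diff x + 1 <= to_diff y.
Proof.
rewrite pa_ltP -to_diff1 -to_diffD -to_diff_le.
by split=> -[z]; rewrite ?pa_addrS -?pa_addSr => <-; exists z;
  rewrite ?pa_addrS ?pa_addSr.
Qed.

Lemma to_diff_nlt x y : ~ lt x y <-> to_diff y <= to_diff x.
Proof.
rewrite pa_ltP; split=> [nlt|yx [z xz]].
  have [z [xz|/esym ->]] := pa_sub_total x y;
    last by rewrite to_diffD lerDl to_diff_ge0.
  case: (pa_cases z) xz => [->|[z' ->]] xz; first by rewrite -xz pa_addr0.
  by case: nlt; exists z'.
move: yx; rewrite -xz !to_diffD gerDl leNgt to_diff1.
by rewrite ltr_wpDl ?ltr01 ?to_diff_ge0.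
Qed.

Lemma to_diff_nle x y : ~ le x y <-> to_diff y + 1 <= to_diff x.
Proof.
rewrite -to_diff_lt to_diff_le -to_diff_nlt; split=> [/contrapT|yx] //.
Qed.

End Transfer.

Ltac transfer_to_diff :=
  repeat match goal with
  | H : @lt ?K _ _ |- _ => apply to_diff_lt in H
  | H : ~ @lt ?K _ _ |- _ => apply to_diff_nlt in H
  | H : @le ?K _ _ |- _ => apply to_diff_le in H
  | H : ~ @le ?K _ _ |- _ => apply to_diff_nle in H
  | H : @eq (carrier ?K) _ _ |- _ => apply (congr1 to_diff) in H
  end;
  match goal with
  | |- @lt _ _ _ => apply to_diff_lt
  | |- ~ @lt _ _ _ => apply to_diff_nlt
  | |- @le _ _ _ => apply to_diff_le
  | |- ~ @le _ _ _ => apply to_diff_nle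
  | |- @eq (carrier _) _ _ => apply to_diff_inj
  | _ => idtac
  end;
  rewrite ?to_diffE;
  repeat match goal with
  | H : context [to_diff (zero _)] |- _ => rewrite !to_diffE in H
  | H : context [to_diff (one _)] |- _ => rewrite !to_diffE in H
  | H : context [to_diff (add _ _)] |- _ => rewrite !to_diffE in H
  | H : context [to_diff (mul _ _)] |- _ => rewrite !to_diffE in H
  end.

Ltac pose_to_diff_ge0 :=
  let pose1 x :=
    let T := type of (to_diff_ge0 x) in
    lazymatch goal with
    | _ : T |- _ => fail
    | _ => have := to_diff_ge0 x; let G := fresh "G" in move=> G
    end in
  repeat match goal with
  | |- context [to_diff ?x] => pose1 x
  | _ : context [to_diff ?x] |- _ => pose1 x
  end.

(* The arithmetic tactics fail in the presence of implications between equations of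
   the model. *)
Ltac clear_non_arithmetic := repeat match goal with
  | H : forall _, _ |- _ => clear H
  | H : ~ _ |- _ => clear H
  | H : @eq ?T _ _ |- _ => lazymatch T with diffring _ => fail | _ => clear H end
  | H : _ \/ _ |- _ => clear H
  | H : _ /\ _ |- _ => clear H
  end.

Ltac pa_lra := transfer_to_diff; clear_non_arithmetic; pose_to_diff_ge0; lra.
Ltac pa_nra := transfer_to_diff; clear_non_arithmetic; pose_to_diff_ge0; nra.
Ltac pa_ring := transfer_to_diff; ring.

Local Open Scope model_scope.

Lemma definable_le (K : structure) (t1 t2 : (nat -> K) -> K) :
  definable_term t1 -> definable_term t2 -> definable (fun e => t1 e <= t2 e).
Proof. by move=> def1 def2; rewrite /le; solve_definable. Qed.

Ltac definable_hook ::= match goal with |- definable _ => apply definable_le end.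

Section OrderAndInduction.
Variable K : peano.
Implicit Types (x y z : K) (A : set K).

Lemma pa_ge0 x : 0 <= x. Proof. by pa_lra. Qed.

Lemma pa_le_refl x : x <= x. Proof. by pa_lra. Qed.

Lemma pa_ltW x y : x < y -> x <= y. Proof. by move=> xy; pa_lra. Qed.

Lemma pa_le_gtF x y : x <= y -> ~ y < x. Proof. by move=> xy; pa_lra. Qed.

Lemma pa_le_trans y x z : x <= y -> y <= z -> x <= z.
Proof. by move=> xy yz; pa_lra. Qed.

Lemma pa_leDl x y : x <= x + y. Proof. by exists y. Qed.

Lemma pa_leP x y : x <= y \/ y < x.
Proof. by have [xy|nxy] := pselect (x <= y); [left|right; pa_lra]. Qed.

Lemma pa_le_neq_lt x y : x <= y -> x <> y -> x < y.
Proof.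
by move=> xy neq; apply: contrapT => nlt; apply: neq; pa_lra.
Qed.

Lemma pa_neq_lt x y : x <> y -> x < y \/ y < x.
Proof. by case: (pa_leP x y) => [xy /(pa_le_neq_lt xy)|]; [left|right]. Qed.

Lemma pa_least A :
  definable1 A -> A !=set0 -> exists x, A x /\ forall y, y < x -> ~ A y.
Proof.
move=> defA [x Ax]; apply: contrapT => /forallNP no_least.
suff none_below z : forall y, y < z -> ~ A y.
  by apply: (none_below (x + 1) x) => //; pa_lra.
move: z; apply: pa_ind => [|y y0|z IH y yz Ay];
  [by solve_definable|by exfalso; pa_lra|].
by apply: (no_least y); split=> // w wy; apply: IH; pa_lra.
Qed.

Lemma pa_last A b : definable1 A -> A 0 -> ~ A b -> exists x, A x /\ ~ A (x + 1).
Proof.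
move=> defA A0 nAb; apply: contrapT => /forallNP no_last; apply: nAb; move: b.
by apply: pa_ind => // x Ax; apply: contrapT => nAx; apply: (no_last x).
Qed.

Lemma pa_divP x y : 0 < y -> exists q, y * q <= x < y * (q + 1).
Proof.
move=> y0; have [|||q [yq yq1]] := @pa_last (fun q => y * q <= x) (x + 1).
- by solve_definable.
- by pa_lra.
- by pa_nra.
by exists q; split=> //; pa_lra.
Qed.

Lemma pa_sqrtP x : exists q, q * q <= x < (q + 1) * (q + 1).
Proof.
have [|||q [qx q1x]] := @pa_last (fun q => q * q <= x) (x + 1).
- by solve_definable.
- by pa_lra.
- by pa_nra.
by exists q; split=> //; pa_lra.
Qed.

Lemma pa_mul_le x y z : x <= y -> z * x <= z * y. Proof. by move=> xy; pa_nra. Qed.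

Lemma pa_mul_leI x y z : 0 < z -> z * x <= z * y -> x <= y.
Proof.
move=> z0 zxy; case: (pa_leP x y) => // yx; exfalso.
by have yx1 : y + 1 <= x by [pa_lra]; have := pa_mul_le z yx1 => ?; pa_lra.
Qed.

Lemma pa_mul_ltI x y z : z * x < z * y -> x < y.
Proof.
by case: (pa_leP y x) => // yx /pa_le_gtF; case; exact: pa_mul_le.
Qed.

Definition pairing (L : structure) (x y : L) : L := (x + y) * (x + y) + x.

Lemma pairing_inj x y x' y' : pairing x y = pairing x' y' -> x = x' /\ y = y'.
Proof.
rewrite /pairing => E; have sumE : x + y = x' + y'.
  by apply: contrapT => /pa_neq_lt [] lt_sum; pa_nra.
rewrite sumE in E; have xE : x = x' by pa_lra.
by split=> //; subst x'; pa_lra.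
Qed.

End OrderAndInduction.

(** * Coding of bounded definable sets, and definable recursion *)

Section Coding.
Variable K : peano.
Implicit Types (c d i j k m n p x y : K) (A : set K).

Definition dvd x y := exists k, y = x * k.

Lemma dvd_mulr p x y : dvd p x -> dvd p (x * y).
Proof. by move=> [k ->]; exists (k * y); pa_ring. Qed.

Lemma dvd_addl p x y : dvd p x -> dvd p (x + y) -> dvd p y.
Proof.
move=> [k ->] [l lE]; have [[z kz]|lk] := pa_leP k l.
  by exists z; rewrite -kz in lE; pa_nra.
by exists 0; have [z] := pa_ltW lk; move=> zE; rewrite -zE in lE *; pa_nra.
Qed.

Lemma common_multiple n : exists2 m, 0 < m & forall i, 0 < i -> i <= n -> dvd i m.
Proof.
suff [m [m0 mP]] : exists m, 0 < m /\ forall i, 0 < i -> i <= n -> dvd i m by exists m.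
move: n; apply: pa_ind => [||n [m [m0 mP]]].
- by rewrite /dvd; solve_definable.
- by exists 1; split=> [|i i0 i_le]; [|exfalso]; pa_lra.
exists (m * (n + 1)); split=> [|i i0 i_le]; first by pa_nra.
have [->|in1] := pselect (i = n + 1); first by exists m; pa_ring.
by apply/dvd_mulr/mP => //; have := pa_le_neq_lt i_le in1 => ?; pa_lra.
Qed.

(* For [m] divisible by the nonzero numbers up to [n], these moduli are pairwise
   coprime for [i <= n]. *)
Definition modulus m i := 1 + (i + 1) * m.

Definition coded c m i := dvd (modulus m i) c.

Lemma dvd_modulus_mul m i x : dvd (modulus m i) (x * m) -> dvd (modulus m i) x.
Proof.
move=> dvd_xm; apply: (@dvd_addl _ (x * m * (i + 1))); first exact: dvd_mulr.
by exists x; rewrite /modulus; pa_ring.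
Qed.

Lemma dvd_modulus_diff m n d j x : (forall i, 0 < i -> i <= n -> dvd i m) ->
  0 < d -> d <= n -> dvd (modulus m j) (x * (d * m)) -> dvd (modulus m j) x.
Proof.
move=> mP d0 dn dvd_xdm; have [k mE] := mP d d0 dn.
apply: (@dvd_modulus_mul m); apply: (@dvd_modulus_mul m).
have -> : x * m * m = x * (d * m) * k by rewrite {2}mE; pa_ring.
exact: dvd_mulr.
Qed.

Lemma coded_extend m n c i j :
  (forall i, 0 < i -> i <= n -> dvd i m) -> i <= n -> j <= n ->
  coded (c * modulus m i) m j <-> coded c m j \/ j = i.
Proof.
move=> mP i_n j_n; split=> [dvd_ci|[|->]]; last 2 first.
- exact: dvd_mulr.
- by exists c; pa_ring.
have [->|/pa_neq_lt ij] := pselect (j = i); [by right|left].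
have [d [d0 dn dvd_d]] : exists d, [/\ 0 < d, d <= n &
    dvd (modulus m j) (c * (d * m))]; last exact: (dvd_modulus_diff mP d0 dn dvd_d).
case: ij => [/pa_ltP [d dE]|/pa_ltP [d dE]]; exists (d + 1); split; try by pa_lra.
- apply: (@dvd_addl _ (c * modulus m j)); first by exists c; pa_ring.
  by move: dvd_ci; congr dvd; rewrite /modulus -dE; pa_ring.
- apply: (dvd_addl dvd_ci); exists c.
  by rewrite /modulus -dE; pa_ring.
Qed.

Lemma definable_coded (t1 t2 t3 : (nat -> K) -> K) : definable_term t1 ->
  definable_term t2 -> definable_term t3 ->
  definable (fun e => coded (t1 e) (t2 e) (t3 e)).
Proof. by move=> def1 def2 def3; rewrite /coded /dvd /modulus; solve_definable. Qed.

Lemma comprehension A n : definable1 A ->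
  exists c m, forall i, i <= n -> (coded c m i <-> A i).
Proof.
move=> defA; have [m m0 mP] := common_multiple n.
suff [c cP] : exists c, forall i, i <= n -> (coded c m i <-> A i /\ i < n + 1).
  exists c, m => i i_n; rewrite cP //; split=> [[]//|Ai]; split=> //; pa_lra.
move: (n + 1); apply: pa_ind => [||z [c cP]].
- apply: definable_ex; apply: definable_all; apply: definable_imp;
    first by solve_definable.
  by apply: definable_iff; [apply: definable_coded|]; solve_definable.
- exists 1 => i i_n; split=> [[k kE]|[_ i0]]; last by exfalso; pa_lra.
  have mod_gt1 : 1 < modulus m i by rewrite /modulus; pa_nra.
  move: (modulus m i) mod_gt1 kE => p p1 kE; exfalso.
  by case: (pa_cases k) kE => [->|[l ->]] kE; [pa_lra|pa_nra].
have [[Az zn]|nAz] := pselect (A z /\ z <= n).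
  exists (c * modulus m z) => i i_n; rewrite (coded_extend c mP) // cP //.
  split=> [[[Ai iz]|->]|[Ai iz]]; [by split=> //; pa_lra|by split=> //; pa_lra|].
  have [->|iz'] := pselect (i = z); [by right|left; split=> //].
  by apply: pa_le_neq_lt => //; pa_lra.
exists c => i i_n; rewrite cP //; split=> -[Ai iz]; split=> //; first by pa_lra.
apply: pa_le_neq_lt; first by pa_lra.
by move=> iz'; apply: nAz; rewrite -iz'.
Qed.

End Coding.

Ltac definable_hook ::= match goal with
  | |- definable _ => first [apply definable_le | apply definable_coded]
  end.

Section Recursion.
Variable K : peano.
Implicit Types (c m n p u v z : K) (h : K -> K -> K).

Definition in_code c m n i u := pairing i u <= n /\ coded c m (pairing i u).

Definition recursion_graph x0 h z v := exists c m n,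
  [/\ forall u, in_code c m n 0 u -> u = x0,
      forall i u, i < z -> in_code c m n (i + 1) u ->
        exists w, in_code c m n i w /\ u = h i w
    & in_code c m n z v].

Lemma definable_recursion_graph x0 (h : (nat -> K) -> K -> K -> K) t1 t2 :
  definable (fun e => e 0%N = h (fun i => e i.+3) (e 1%N) (e 2)) ->
  definable_term t1 -> definable_term t2 ->
  definable (fun e => recursion_graph x0 (h e) (t1 e) (t2 e)).
Proof.
move=> defh def1 def2.
pose S e := exists c m n,
  (forall u, in_code c m n 0 u -> u = x0) /\
  (forall i u, i < e 0%N -> in_code c m n (i + 1) u ->
     exists w, in_code c m n i w /\ u = h (fun j => e j.+2) i w) /\
  in_code c m n (e 0%N) (e 1%N).
have defS : definable S.
  rewrite /S /in_code /pairing.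
  have def_step : definable (fun e => e 1%N = h (fun j => e j.+4.+4) (e 2) (e 0%N)).
    apply: (definable_subst (T := fun j e =>
      match j with 0 => e 1%N | 1 => e 2 | 2 => e 0%N | j.+3 => e j.+4.+4 end) defh).
    by case=> [|[|[|j]]]; apply: definable_term_var.
  by repeat first [exact: def_step | definable_step].
apply: (definable_ext (S := fun e => S (fun i =>
  match i with 0 => t1 e | 1 => t2 e | i.+2 => e i end))) => [e|].
  split=> -[c [m [n]]]; first by move=> [base [step final]]; exists c, m, n.
  by move=> [base step final]; exists c, m, n.
apply: (definable_subst (T := fun i e =>
  match i with 0 => t1 e | 1 => t2 e | i.+2 => e i end) defS).
by case=> [|[|i]] //; apply: definable_term_var.
Qed.

Lemma recursion_graph_uniq x0 h z v v' :
  recursion_graph x0 h z v -> recursion_graph x0 h z v' -> v = v'.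
Proof.
move=> [c [m [n [base step final]]]] [c' [m' [n' [base' step' final']]]].
suff uniq i : i <= z ->
  forall u u', in_code c m n i u -> in_code c' m' n' i u' -> u = u'.
  by apply: uniq final final'; pa_lra.
move: i; apply: pa_ind => [||i IH iz u u'].
- by rewrite /in_code /pairing; solve_definable.
- by move=> _ u u' /base -> /base' ->.
have i_lt_z : i < z by pa_lra.
move=> /(step _ _ i_lt_z) [w [iw ->]] /(step' _ _ i_lt_z) [w' [iw' ->]].
by rewrite (IH _ w w') //; exact: pa_ltW.
Qed.

Section RecursionExists.
Variables (x0 : K) (h : K -> K -> K).
Hypothesis defh : definable_fun2 h.

Lemma recursion_graph0 : recursion_graph x0 h 0 x0.
Proof.
have [|c [m cP]] := @comprehension K (fun p => p = pairing 0 x0) (pairing 0 x0).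
  by rewrite /pairing; solve_definable.
exists c, m, (pairing 0 x0).
split=> [u [u_le /cP -/(_ u_le) /pairing_inj []]//|i u i0|].
  by exfalso; pa_lra.
by split; [exact: pa_le_refl|apply/cP; first exact: pa_le_refl].
Qed.

Lemma recursion_graphS z v :
  recursion_graph x0 h z v -> recursion_graph x0 h (z + 1) (h z v).
Proof.
move=> [c [m [n [base step final]]]]; pose n' := n + pairing (z + 1) (h z v).
pose graph i u := (i <= z /\ in_code c m n i u) \/ (i = z + 1 /\ u = h z v).
have [|c' [m' codeP]] := @comprehension K
    (fun p => exists i u, p = pairing i u /\ graph i u) n'.
  by rewrite /graph /in_code /pairing; solve_definable.
have in_codeE i u : in_code c' m' n' i u <-> graph i u.
  split=> [[iu_n' /codeP -/(_ iu_n') [i' [u' [/pairing_inj [-> ->]]]]]//|iu].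
  have iu_n' : pairing i u <= n'.
    case: iu => [[_ [iu_n _]]|[-> ->]]; rewrite /n'; move: (pairing (z + 1) _) => p.
      by move: (pairing i u) iu_n => q q_n; pa_lra.
    by pa_lra.
  by split=> //; apply/codeP => //; exists i, u.
exists c', m', n'; split=> [u /in_codeE [[_ /base]//|[E _]]|i u iz|].
- by exfalso; pa_lra.
- move=> /in_codeE [[iz1 /step]|[/pa_addIr -> ->]].
    case=> [|w [iw ->]]; first by pa_lra.
    by exists w; split=> //; apply/in_codeE; left; split=> //; pa_lra.
  by exists v; split=> //; apply/in_codeE; left; split=> //; exact: pa_le_refl.
- by apply/in_codeE; right.
Qed.

Lemma recursion_graph_total z : exists v, recursion_graph x0 h z v.
Proof.
move: z; apply: pa_ind => [||z [v zv]]; last by exists (h z v); exact: recursion_graphS.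
- apply: definable_ex.
  apply: (@definable_recursion_graph x0 (fun _ => h) (fun e => e 1%N) (fun e => e 0%N));
    [exact: defh|exact: definable_term_var..].
- by exists x0; exact: recursion_graph0.
Qed.

End RecursionExists.

Definition recursion x0 h z : K :=
  xget (0 : {classic K}) [set v | recursion_graph x0 h z v].

Lemma recursionP x0 h z : definable_fun2 h -> recursion_graph x0 h z (recursion x0 h z).
Proof. by move=> defh; apply: xgetPex; exact: recursion_graph_total. Qed.

Lemma recursion0 x0 h : definable_fun2 h -> recursion x0 h 0 = x0.
Proof.
move=> defh; apply: (recursion_graph_uniq (recursionP x0 0 defh)).
exact: recursion_graph0.
Qed.

Lemma recursionS x0 h z :
  definable_fun2 h -> recursion x0 h (z + 1) = h z (recursion x0 h z).
Proof.
move=> defh; apply: (recursion_graph_uniq (recursionP x0 (z + 1) defh)).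
by apply: recursion_graphS => //; exact: recursionP.
Qed.

Lemma definable_term_recursion x0 (h : (nat -> K) -> K -> K -> K) t :
  definable (fun e => e 0%N = h (fun i => e i.+3) (e 1%N) (e 2)) -> definable_term t ->
  definable_term (fun e => recursion x0 (h e) (t e)).
Proof.
move=> defh deft.
have defhe e : definable_fun2 (h e).
  apply: (definable_subst (T := fun i e' => if i is j.+3 then e j else e' i) defh).
  by case=> [|[|[|i]]]; [exact: definable_term_var..|exact: definable_term_const].
apply: (definable_ext (S := fun e => recursion_graph x0 (h (fun i => e i.+1))
  (t (fun i => e i.+1)) (e 0%N))) => [e|].
  split=> [graph_e|->]; last exact: recursionP.
  exact: recursion_graph_uniq graph_e (recursionP _ _ (defhe _)).
apply: (@definable_recursion_graph x0 (fun e => h (fun i => e i.+1))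
  (fun e => t (fun i => e i.+1)) (fun e => e 0%N)).
- apply: (definable_subst (T := fun i e => if i is j.+3 then e j.+4 else e i) defh).
  by case=> [|[|[|i]]]; exact: definable_term_var.
- exact: definable_term_tail.
- exact: definable_term_var.
Qed.

End Recursion.

(** * Counting bounded definable sets *)

Section Counting.
Variable K : peano.
Implicit Types (y z : K) (A : set K).

Definition count_step A i u : K := if `[< A i >] then u + 1 else u.

Definition cnt A z : K := recursion 0 (count_step A) z.

Lemma definable_count_step (A : K -> (nat -> K) -> Prop) k :
  definable (fun e => A (e 0%N) (fun i => e i.+1)) ->
  definable (fun e =>
    e 0%N = count_step (fun y => A y (fun i => e (i + k)%N)) (e 1%N) (e 2)).
Proof.
move=> defA.
have defA' := definable_family (fun i => (i + k)%N) defA (definable_term_var _ 1%N).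
by rewrite /count_step; solve_definable.
Qed.

Lemma definable_term_cnt (A : K -> (nat -> K) -> Prop) t :
  definable (fun e => A (e 0%N) (fun i => e i.+1)) -> definable_term t ->
  definable_term (fun e => cnt (fun y => A y e) (t e)).
Proof.
move=> defA deft.
apply: (@definable_term_recursion K 0 (fun e => count_step (A^~ e))) => //.
have := definable_count_step 3 defA; apply: definable_ext => e.
by rewrite (_ : (fun i => e (i + 3)%N) = fun i => e i.+3) //; apply/funext => i;
  rewrite addn3.
Qed.

Lemma definable_fun2_count_step A : definable1 A -> definable_fun2 (count_step A).
Proof. exact: (definable_count_step (A := fun y _ => A y) 0). Qed.

Lemma cnt0 A : definable1 A -> cnt A 0 = 0.
Proof. by move=> /definable_fun2_count_step; exact: recursion0. Qed.

Lemma cntS_in A z : definable1 A -> A z -> cnt A (z + 1) = cnt A z + 1.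
Proof.
by move=> /definable_fun2_count_step defA Az;
  rewrite /cnt recursionS // /count_step asboolT.
Qed.

Lemma cntS_notin A z : definable1 A -> ~ A z -> cnt A (z + 1) = cnt A z.
Proof.
by move=> /definable_fun2_count_step defA nAz;
  rewrite /cnt recursionS // /count_step asboolF.
Qed.

End Counting.

Ltac definable_hook ::= match goal with
  | |- definable_term _ => apply definable_term_cnt
  | |- definable _ => first [apply definable_le | apply definable_coded]
  end.

Section CountingLemmas.
Variable K : peano.
Implicit Types (x y z : K) (A B C : set K).

Lemma pa_bounded_ind A z : definable1 A ->
  A 0 -> (forall i, i < z -> A i -> A (i + 1)) -> A z.
Proof.
move=> defA A0 AS; suff below i : i <= z -> A i by apply: below; exact: pa_le_refl.
move: i; apply: pa_ind => // [|i IH iz]; first by solve_definable.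
by apply: AS; [|apply: IH]; pa_lra.
Qed.

Lemma cnt_leS A z : definable1 A -> cnt A z <= cnt A (z + 1).
Proof.
move=> defA; have [Az|nAz] := pselect (A z); first by rewrite cntS_in //; pa_lra.
by rewrite cntS_notin //; exact: pa_le_refl.
Qed.

Lemma cnt_le_add A B C z : definable1 A -> definable1 B -> definable1 C ->
  (forall y, y < z -> A y -> B y \/ C y) -> cnt A z <= cnt B z + cnt C z.
Proof.
move=> defA defB defC ABC.
apply: (pa_bounded_ind (A := fun i => cnt A i <= cnt B i + cnt C i)).
- by solve_definable.
- by rewrite !cnt0 //; pa_lra.
move=> i iz IH; have leB := cnt_leS i defB; have leC := cnt_leS i defC.
have [Ai|nAi] := pselect (A i); last by rewrite (cntS_notin defA) //; pa_lra.
case: (ABC i iz Ai) => [Bi|Ci].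
  by rewrite (cntS_in defA) // (cntS_in defB) //; pa_lra.
by rewrite (cntS_in defA) // (cntS_in defC) //; pa_lra.
Qed.

Lemma cnt_all A z : definable1 A -> (forall y, y < z -> A y) -> cnt A z = z.
Proof.
move=> defA all_A; apply: (pa_bounded_ind (A := fun i => cnt A i = i)) => [||i iz IH].
- by solve_definable.
- by rewrite cnt0.
- by rewrite cntS_in ?IH //; exact: all_A.
Qed.

Lemma cnt_none A z : definable1 A -> (forall y, y < z -> ~ A y) -> cnt A z = 0.
Proof.
move=> defA no_A; apply: (pa_bounded_ind (A := fun i => cnt A i = 0)) => [||i iz IH].
- by solve_definable.
- by rewrite cnt0.
- by rewrite cntS_notin //; exact: no_A.
Qed.

Lemma cnt_le A B z : definable1 A -> definable1 B ->
  (forall y, y < z -> A y -> B y) -> cnt A z <= cnt B z.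
Proof.
move=> defA defB AB; have def0 : definable1 (set0 : set K) by solve_definable.
have := cnt_le_add defA defB def0 (fun y yz Ay => or_introl (AB y yz Ay)).
by rewrite (cnt_none def0) => [?|y _ []]; pa_lra.
Qed.

Lemma cnt_gt0 A z : definable1 A -> 0 < cnt A z -> exists y, y < z /\ A y.
Proof.
move=> defA cnt_pos; apply: contrapT => no; apply: (@pa_le_gtF _ _ 0 _ cnt_pos).
by rewrite cnt_none //; [exact: pa_le_refl|move=> y yz Ay; apply: no; exists y].
Qed.

Lemma cnt_set1 x z : cnt [set x] z <= 1.
Proof.
have def_x : definable1 [set x] by solve_definable.
suff [] : cnt [set x] z <= 1 /\ (z <= x -> cnt [set x] z = 0) by [].
apply: (pa_bounded_ind (A := fun z =>
  cnt [set x] z <= 1 /\ (z <= x -> cnt [set x] z = 0))).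
- by solve_definable.
- by rewrite cnt0 //; split=> //; exact: pa_ge0.
move=> i _ [le1 eq0]; have [ix|ix] := pselect (i = x).
  rewrite cntS_in // eq0; last by rewrite ix; exact: pa_le_refl.
  by split=> [|i1x]; [|exfalso]; pa_lra.
by rewrite cntS_notin //; split=> // i1x; apply: eq0; pa_lra.
Qed.

Lemma cnt_le_add1 A B C x z : definable1 A -> definable1 B -> definable1 C ->
  (forall y, A y -> y <> x -> B y \/ C y) -> cnt A z <= cnt B z + cnt C z + 1.
Proof.
move=> defA defB defC ABC; have def_x : definable1 [set x] by solve_definable.
have defBC : definable1 (B `|` C) by solve_definable.
have le_BC : cnt (B `|` C) z <= cnt B z + cnt C z by exact: cnt_le_add.
have le_x := cnt_set1 x z.
suff : cnt A z <= cnt (B `|` C) z + cnt [set x] z by move=> ?; pa_lra.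
apply: cnt_le_add => // y _ Ay.
by have [yx|yx] := pselect (y = x); [right|left; exact: ABC].
Qed.

End CountingLemmas.

(** * Standard and nonstandard elements *)

Section Nonstandard.
Variable K : peano.
Implicit Types x y z s t u P : K.

Lemma numeralM m n : (m * n)%:R = (m%:R : K) * n%:R.
Proof. by apply: to_diff_inj; rewrite to_diffM !to_diff_numeral GRing.natrM. Qed.

Lemma lt_numeral n x : x < n%:R -> exists2 m, (m < n)%N & x = m%:R.
Proof.
elim: n => [|n IH] /= xn; first by exfalso; pa_lra.
have [/IH [m mn ->]|nxn] := pselect (x < n%:R); first by exists m => //; apply: ltnW.
by exists n => //; pa_lra.
Qed.

Lemma numeral_lt m n : (m < n)%N -> (m%:R : K) < n%:R.
Proof.
elim: n => // n IH; rewrite ltnS leq_eqVlt => /orP [/eqP ->|/IH mn] /=; pa_lra.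
Qed.

Lemma peano_ordinary : ordinary K.
Proof.
split=> [m n|x y [n _ <-] /lt_numeral [m _ ->]]; last by exists m.
split=> [|mn]; first exact: numeral_lt.
rewrite ltnNge leq_eqVlt; apply/negP => /orP [/eqP E|/numeral_lt nm]; last by pa_lra.
by rewrite E in mn; pa_lra.
Qed.

Definition nonstandard (L : structure) (x : L) := forall n, n%:R < x.

Lemma nonstandardP x : ~ standard x <-> nonstandard x.
Proof.
split=> [nstd n|nstd [n _ E]]; last by have := nstd n; rewrite E => ?; pa_lra.
apply: contrapT => nx; apply: nstd.
have /lt_numeral [m _ ->] : x < n.+1%:R by rewrite /=; pa_lra.
by exists m.
Qed.

Lemma nonstandard_gt1 P : nonstandard P -> 1 < P.
Proof. by move=> /(_ 1%N) /= P1; pa_lra. Qed.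

Lemma nonstandard_sqrt P u : nonstandard P -> P < (u + 1) * (u + 1) -> nonstandard u.
Proof.
move=> P_nonstd Pu n; case: (pa_leP u n%:R) => // u_n; exfalso.
by have := P_nonstd (n.+1 * n.+1)%N; rewrite numeralM /= => P_gt; pa_nra.
Qed.

Lemma power_le x y n : x <= y -> x ^ n <= y ^ n.
Proof. by move=> xy; elim: n => [|n IH] /=; [pa_lra|pa_nra]. Qed.

Lemma power_gt0 x n : 0 < x -> 0 < x ^ n.
Proof. by move=> x0; elim: n => [|n IH] /=; [pa_lra|pa_nra]. Qed.

Lemma powerM x m n : x ^ (m * n) = (x ^ m) ^ n.
Proof. by apply: to_diff_inj; rewrite !to_diffX GRing.exprM. Qed.

Lemma power_numeral m n : (m%:R : K) ^ n = (m ^ n)%:R.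
Proof. by apply: to_diff_inj; rewrite to_diffX !to_diff_numeral GRing.natrX. Qed.

Lemma power4_ge P u : 1 < u -> P < (u + 1) * (u + 1) -> P <= u ^ 4.
Proof.
move=> u1 Pu /=; have u_uu : u + 1 <= u * u by pa_nra.
by have := pa_mul_le (u + 1) u_uu; have := pa_mul_le (u * u) u_uu => *; pa_lra.
Qed.

Definition negligible x y := forall n, n%:R * x < y.

Lemma negligible_le x x' y : x' <= x -> negligible x y -> negligible x' y.
Proof. by move=> x'x xy n; have := xy n => ?; pa_nra. Qed.

Lemma negligible_gt0 x y : negligible x y -> 0 < y.
Proof. by move=> /(_ 0%N) /=; rewrite pa_mul0r. Qed.

Lemma negligible_scale k x y z : negligible x y -> y <= k%:R * z -> negligible x z.
Proof.
move=> xy ykz n; have := xy (k * n)%N; rewrite numeralM => kn_y.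
by case: (pa_leP z (n%:R * x)) => // zn; exfalso;
  have := pa_mul_le k%:R zn => ?; pa_lra.
Qed.

Lemma negligible_divide P s t k u : 0 < P -> negligible (s * P) t ->
  t <= k%:R * P * u -> negligible s u.
Proof.
move=> P0 sPt tkPu n; have := sPt (k * n)%N; rewrite numeralM => kn_t.
by case: (pa_leP u (n%:R * s)) => // un; exfalso;
  have := pa_mul_le (k%:R * P) un => ?; pa_lra.
Qed.

End Nonstandard.

(** * Separating a definable function from the inverse of an external map *)

Section Pigeonhole.
Variable K : peano.
Implicit Types x d r s t v w P : K.

Lemma pigeonhole_increment (G : K -> K) d s w r :
  definable_fun G -> 0 < r -> s <= r * w ->
  exists x x', [/\ d <= x, x <= x', x' <= x + w, x' <= d + s &
    G (d + s) + r * G x <= G d + r * G x'].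
Proof.
move=> defG r0 s_rw; apply: contrapT => none.
have small x x' : d <= x -> x <= x' -> x' <= x + w -> x' <= d + s ->
    G d + r * G x' < G (d + s) + r * G x.
  move=> dx xx' x'w x's.
  case: (pa_leP (G (d + s) + r * G x) (G d + r * G x')) => // big.
  by case: none; exists x, x'.
suff growth i : forall x, d <= x -> x <= d + s -> x <= d + i * w ->
    r * G x + i * G d + i <= r * G d + i * G (d + s).
  have s_le : d + s <= d + r * w by pa_lra.
  by have := growth r (d + s) (pa_leDl _ _) (pa_le_refl _) s_le => ?; pa_lra.
move: i; apply: pa_ind => [||i IH x dx xs x_iw]; first by solve_definable.
  by move=> x dx _ x0; have -> : x = d; pa_lra.
have [xw|xw] := pa_leP x (d + w).
  have := IH d (pa_le_refl d) (pa_leDl _ _) (pa_leDl _ _).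
  by have := small d x (pa_le_refl d) dx xw xs => *; pa_lra.
have [z zE] : w <= x by pa_lra.
have [dz zx xzw zs] : [/\ d <= z, z <= x, x <= z + w & z <= d + s].
  by clear - xw xs zE; split; pa_lra.
have z_iw : z <= d + i * w by clear - zE x_iw; pa_lra.
have small_z := small z x dz zx xzw xs; have IH_z := IH z dz zs z_iw.
by clear - small_z IH_z; pa_lra.
Qed.

(* Below, [G] and [H] are the values at [d], [x], [x'] and [d + s] of two functions
   that differ by little, [r * (G x' - G x)] is at least [G (d + s) - G d], and
   [H] grows by [t] between [d] and [d + s] and by at most [v] between [x] and [x']. *)
Lemma large_increment P r t v Gd Gx Gx' Gs Hx Hx' ud ux ux' us :
  1 < P -> r <= P + P -> 32%:R * P <= t ->
  16%:R * P * ud < t -> 16%:R * P * ux < t -> 16%:R * P * ux' < t ->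
  16%:R * P * us < t ->
  Gd <= 1 + ud -> Hx <= Gx + ux -> Gx' <= Hx' + 1 + ux' -> t <= Gs + us ->
  Gs + r * Gx <= Gd + r * Gx' -> Hx' <= Hx + v -> t <= 8%:R * r * v.
Proof.
move=> P1 r_2P t32 hud hux hux' hus Gd_le Hx_le Gx'_le t_le incr Hx'_le.
have Gx'_le_Gx : Gx' <= Gx + (ux + v + 1 + ux') by clear - Hx_le Gx'_le Hx'_le; pa_lra.
have r_incr := pa_mul_le r Gx'_le_Gx; have r_err := pa_mul_le (ux + 1 + ux') r_2P.
have ud_P := pa_mul_le ud (pa_ltW P1); have us_P := pa_mul_le us (pa_ltW P1).
clear Hx_le Gx'_le Hx'_le Gx'_le_Gx; rewrite /= in t32 hud hux hux' hus *.
by pa_lra.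
Qed.

End Pigeonhole.

Section Separation.
Variables (K : peano) (F : K -> K) (a : K).
Implicit Types (x y d s w P : K) (Y : set K).

Local Notation size Y := (cnt Y (F a)).

Definition spread P Y d s := [/\ definable1 Y, d + s <= a,
  forall y, Y y -> F d <= y < F (d + s) & negligible (s * P) (size Y)].

Definition separated (g : K -> K) Y := exists2 x, x <= a &
  (forall y, Y y -> g y <= x /\ F x < y) \/ (forall y, Y y -> x <= g y /\ y < F x).

Lemma spread_gt0 P Y d s : spread P Y d s -> 0 < s.
Proof.
move=> [defY _ Yds sP]; case: (pa_cases s) Yds => [->|[s' ->] _]; last by pa_lra.
have [y [_ Yy]] := cnt_gt0 defY (negligible_gt0 sP).
by rewrite pa_addr0 => /(_ y Yy) [/pa_le_gtF].
Qed.

Lemma spread_large n P Y d s :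
  nonstandard P -> spread (P * P) Y d s -> n%:R * P <= size Y.
Proof.
move=> nP spreadY; have [_ _ _ PP_Y] := spreadY.
have s1 : 1 <= s by have := spread_gt0 spreadY => ?; pa_lra.
have P_PP : P <= P * P by have := nonstandard_gt1 nP => ?; pa_nra.
apply: pa_le_trans (pa_ltW (PP_Y n)); apply: pa_mul_le; apply: pa_le_trans P_PP _.
by have := pa_mul_le (P * P) s1 => ?; pa_lra.
Qed.

Variable g : K -> K.
Hypothesis def_g : definable_fun g.

Definition separable P Y s := exists d1 s1 Y1,
  [/\ spread P Y1 d1 s1, Y1 `<=` Y, s1 <= s & separated g Y1].

(* [g y] is meant to approximate the possibly missing inverse image of [y] by [F]. *)
Definition underestimated Y x : set K := [set y | Y y /\ (g y <= x /\ F x < y)].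
Definition overestimated Y x : set K := [set y | Y y /\ (x <= g y /\ y < F x)].

Lemma definable_underestimated Y x : definable1 Y -> definable1 (underestimated Y x).
Proof. by move=> defY; rewrite /underestimated; solve_definable. Qed.

Lemma definable_overestimated Y x : definable1 Y -> definable1 (overestimated Y x).
Proof. by move=> defY; rewrite /overestimated; solve_definable. Qed.

Lemma separable_side P P' Y d s Y1 x : spread P' Y d s -> x <= a ->
  Y1 = underestimated Y x \/ Y1 = overestimated Y x ->
  negligible (s * P) (size Y1) -> separable P Y s.
Proof.
move=> [defY dsa Yds _] xa sideY1 sP; exists d, s, Y1.
have Y1Y : Y1 `<=` Y by case: sideY1 => -> y [].
split=> //; [split=> // [|y /Y1Y /Yds //]|exact: pa_le_refl|exists x => //].
  by case: sideY1 => ->;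
    [exact: definable_underestimated|exact: definable_overestimated].
by case: sideY1 => ->; [left|right] => y [].
Qed.

Lemma separable_unit P Y d :
  nonstandard P -> spread (P * P) Y d 1 -> separable P Y 1.
Proof.
move=> nP spreadY; have P1 := nonstandard_gt1 nP.
have [defY d1a Yd1 PP_Y] := spreadY.
pose U := underestimated Y d; pose O := overestimated Y (d + 1).
have le_UO : size Y <= size U + size O + 1.
  apply: (@cnt_le_add1 _ Y U O (F d)) => //.
  - exact: definable_underestimated.
  - exact: definable_overestimated.
  move=> y Yy y_Fd; have [Fd_y y_F] := Yd1 y Yy.
  have [gd|gd] := pa_leP (g y) d; [left|right]; do !split=> //; last by pa_lra.
  exact: pa_le_neq_lt Fd_y (nesym y_Fd).
have P_PP : 1 * P <= 1 * (P * P) by pa_nra.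
have Y4 : 4%:R < size Y by have := PP_Y 4%N => /= ?; pa_nra.
rewrite /= in Y4.
have large Z : size Y <= 3%:R * size Z -> negligible (1 * P) (size Z).
  move=> YZ; apply: (negligible_le P_PP); exact: negligible_scale PP_Y YZ.
have [UO|OU] := pa_leP (size U) (size O).
  apply: (separable_side (x := d + 1) spreadY) => //; first by right.
  by apply: large; rewrite /=; pa_lra.
apply: (separable_side (x := d) spreadY); [by pa_lra|by left|].
by apply: large; rewrite /=; pa_lra.
Qed.

Lemma cnt_below_le_add Y x : definable1 Y -> x <= a ->
  size [set y | Y y /\ g y <= x] <=
  size [set y | Y y /\ y < F x] + 1 + size (underestimated Y x) /\
  size [set y | Y y /\ y < F x] <=
  size [set y | Y y /\ g y <= x] + size (overestimated Y x).
Proof.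
move=> defY xa; have defU := definable_underestimated x defY.
have defO := definable_overestimated x defY.
split; last first.
  apply: cnt_le_add => //; try by solve_definable.
  move=> y _ [Yy yF]; have [gx|gx] := pa_leP (g y) x; [by left|right].
  by do !split=> //; exact: pa_ltW.
suff ? : size [set y | Y y /\ g y <= x] <=
  size [set y | Y y /\ y < F x] + size (underestimated Y x) + 1 by pa_lra.
apply: (@cnt_le_add1 _ _ _ _ (F x)) => //; try by solve_definable.
move=> y [Yy gx] y_Fx; case: (pa_neq_lt y_Fx) => [yF|Fy]; [by left|by right].
Qed.

Definition has_no_large_side P Y := forall x, x <= a ->
  16%:R * P * size (underestimated Y x) < size Y /\
  16%:R * P * size (overestimated Y x) < size Y.

(* If [g] has no large side then [x |-> |{y in Y | g y <= x}|] is a definable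
   approximation of the undefinable [x |-> |{y in Y | y < F x}|], and the pigeonhole
   principle applies to the former. *)
Lemma steep_subinterval P Y d s w r : nonstandard P -> spread (P * P) Y d s ->
  has_no_large_side P Y -> 0 < r -> s <= r * w -> r <= P + P ->
  exists x s1, [/\ x + s1 <= a, s1 <= w &
    size Y <= 8%:R * r * size [set y | Y y /\ F x <= y < F (x + s1)]].
Proof.
move=> nP spreadY no_side r0 s_rw r_2P; have P1 := nonstandard_gt1 nP.
have [defY dsa Yds _] := spreadY.
pose G x := size [set y | Y y /\ g y <= x].
have [|x [x' [dx [s1 x'E] x'w x's incr]]] :=
  @pigeonhole_increment K G d s w r _ r0 s_rw.
  by rewrite /G; solve_definable.
have xa' : x' <= a := pa_le_trans x's dsa.
have xa : x <= a by apply: pa_le_trans xa'; exists s1.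
have da : d <= a := pa_le_trans (pa_leDl d s) dsa.
exists x, s1; split; [by rewrite x'E|by clear - x'E x'w; pa_lra|rewrite x'E].
have no_below : size [set y | Y y /\ y < F d] = 0.
  apply: cnt_none => [|y _ [/Yds [Fd_y _] /pa_le_gtF]//]; by solve_definable.
have [Gd_le _] := cnt_below_le_add defY da; rewrite no_below pa_add0r in Gd_le.
have [_ Hx_le] := cnt_below_le_add defY xa.
have [Gx'_le _] := cnt_below_le_add defY xa'.
have [_ Hs_le] := cnt_below_le_add defY dsa.
have t_le : size Y <= G (d + s) + size (overestimated Y (d + s)).
  apply: pa_le_trans Hs_le.
  by apply: cnt_le => [||y _ Yy]; [|solve_definable|by split=> //; have [] := Yds y Yy].
have Hx'_le : size [set y | Y y /\ y < F x'] <=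
    size [set y | Y y /\ y < F x] + size [set y | Y y /\ F x <= y < F x'].
  apply: cnt_le_add => [|||y _ [Yy yF]]; try by solve_definable.
  by have [Fy|yFx] := pa_leP (F x) y; [right|left].
exact: (large_increment P1 r_2P (spread_large 32 nP spreadY)
  (no_side _ da).1 (no_side _ xa).2 (no_side _ xa').1
  (no_side _ dsa).2 Gd_le Hx_le Gx'_le t_le incr Hx'_le).
Qed.

Lemma negligible_subinterval P s s1 w r t v : negligible (s * P) t ->
  t <= 8%:R * r * v -> w * r <= s + s -> s1 <= w -> negligible (s1 * P) v.
Proof.
move=> sPt t_rv wr s1w n; case: (pa_leP v (n%:R * (s1 * P))) => // v_le; exfalso.
have := sPt (16 * n)%N; rewrite (numeralM K 16 n) (numeralM K 2 8).
have := pa_mul_le (8%:R * r) v_le.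
have := pa_mul_le (8%:R * r * n%:R * P) s1w.
have := pa_mul_le (8%:R * n%:R * P) wr.
by move: (numeral K 8) t_rv => c t_rv /= *; pa_lra.
Qed.

Lemma separable_or_subinterval P Y d s w : nonstandard P -> spread (P * P) Y d s ->
  0 < w -> w < s -> s <= w * P ->
  separable P Y s \/
  exists x s1 Y1, [/\ spread (P * P) Y1 x s1, Y1 `<=` Y & s1 <= w].
Proof.
move=> nP spreadY w0 ws s_wP; have [defY dsa Yds PP_Y] := spreadY.
have P1 := nonstandard_gt1 nP.
have [no_side|/existsNP [x /not_implyP [xa /not_andP large]]] :=
  pselect (has_no_large_side P Y); [right|left]; last first.
  have divide Z : ~ 16%:R * P * size Z < size Y -> negligible (s * P) (size Z).
    move=> ZY; apply: (@negligible_divide _ P _ (size Y) 16); first by pa_lra.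
      by move: PP_Y; congr negligible; pa_ring.
    by move: (16%:R) ZY => k ZY; pa_lra.
  by case: large => /divide sP; apply: separable_side spreadY xa _ sP; [left|right].
have [q [wq_s s_wq]] := pa_divP s w0; pose r := q + 1.
have q_P : q <= P by apply: (pa_mul_leI w0); pa_lra.
have [|||x [s1 [xa s1w Y_le]]] := @steep_subinterval P Y d s w r nP spreadY no_side.
- by rewrite /r; pa_lra.
- by rewrite /r; pa_lra.
- by rewrite /r; pa_lra.
exists x, s1, [set y | Y y /\ F x <= y < F (x + s1)]; split=> [|y []//|//].
split=> // [|y []//|]; first by solve_definable.
by apply: (negligible_subinterval PP_Y Y_le _ s1w); rewrite /r; pa_lra.
Qed.

Lemma spread_separable P n Y d s :
  nonstandard P -> spread (P * P) Y d s -> s <= P ^ n ->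
  separable P Y s.
Proof.
move=> nP; have P1 := nonstandard_gt1 nP.
elim: n Y d s => [|n IH] Y d s spreadY /= s_le.
  have s0 := spread_gt0 spreadY; have sE : s = 1 by pa_lra.
  by rewrite sE in spreadY *; exact: separable_unit spreadY.
have [s_n|n_s] := pa_leP s (P ^ n); first exact: IH spreadY s_n.
have P0 : 0 < P ^ n by apply: power_gt0; pa_lra.
have [//|[x [s1 [Y1 [spreadY1 Y1Y s1_le]]]]] :=
  separable_or_subinterval nP spreadY P0 n_s s_le.
have [d2 [s2 [Y2 [spreadY2 Y2Y1 s2_le sepY2]]]] := IH _ _ _ spreadY1 s1_le.
exists d2, s2, Y2; split=> //; first exact: subset_trans Y1Y.
by pa_lra.
Qed.

End Separation.

(** * Forcing conditions *)

Definition dense (T : Type) (C Q : set (set T)) :=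
  forall Y, C Y -> exists Y', [/\ C Y', Y' `<=` Y & Q Y'].

Section Gaps.
Variable K : structure.
Implicit Types (L R Y : set K).

Definition gap L R := R !=set0 /\
  forall z, (exists2 l, L l & z <= l) \/ (exists2 r, R r & r <= z).

Definition avoids (g : K -> K) L R Y :=
  (exists2 l, L l & forall y, Y y -> g y <= l) \/
  (exists2 r, R r & forall y, Y y -> r <= g y).

End Gaps.

Section Conditions.
Variable K : peano.
Implicit Types (x y d s v P : K) (g : K -> K) (A L R Y Z : set K).

(* Cut [Y] at the least [v] such that [g y <= v] for many [y] in [Y]. *)
Lemma split_avoids (many : set (set K)) g Y L R :
  definable_fun g -> gap L R -> many Y ->
  (forall v, many (Y `&` [set y | g y <= v]) \/ many (Y `&` [set y | v < g y])) ->
  definable1 [set v | many (Y `&` [set y | g y <= v])] ->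
  exists A, [/\ definable1 A, many (Y `&` A) & avoids g L R (Y `&` A)].
Proof.
move=> def_g [[r0 Rr0] gapLR] manyY split_many def_many.
have [/(pa_least def_many) [v [many_v least_v]]|none] :=
    pselect ([set v | many (Y `&` [set y | g y <= v])] !=set0); last first.
  have [many_r0|many_r0] := split_many r0; first by case: none; exists r0.
  exists [set y | r0 < g y]; split=> //; first by solve_definable.
  by right; exists r0 => // y [_ /pa_ltW].
have [[l Ll vl]|[r Rr rv]] := gapLR v.
  exists [set y | g y <= v]; split=> //; first by solve_definable.
  by left; exists l => // y [_ gv]; exact: pa_le_trans vl.
case: (pa_cases v) rv least_v => [-> r_0 _|[w ->] r_w least_w].
  exists setT; rewrite setIT; split=> //; first by solve_definable.
  by right; exists r => // y _; apply: pa_le_trans r_0 (pa_ge0 _).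
have [many_w|many_w] := split_many w; first by case: (least_w w) => //; pa_lra.
exists [set y | w < g y]; split=> //; first by solve_definable.
by right; exists r => // y [_ /= w_gy]; pa_lra.
Qed.

Definition unbounded Y := definable1 Y /\ forall x, exists y, Y y /\ x < y.

Lemma unbounded_avoids g L R :
  definable_fun g -> gap L R -> dense unbounded (avoids g L R).
Proof.
move=> def_g gapLR Y [defY unbY].
have [||A [defA unbA avA]] := @split_avoids (fun Z => forall x, exists y, Z y /\ x < y)
    g Y L R def_g gapLR unbY.
- move=> v; have [|/existsNP [x0 bounded]] :=
    pselect (forall x, exists y, (Y `&` [set y | g y <= v]) y /\ x < y);
      [by left|right].
  move=> x; have [y [Yy xy]] := unbY (x + x0); exists y; split; last by pa_lra.
  split=> //; case: (pa_leP (g y) v) => // gv.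
  by case: bounded; exists y; split=> //; pa_lra.
- by solve_definable.
by exists (Y `&` A); split=> //; split=> //; solve_definable.
Qed.

Variables (F : K -> K) (a : K).
Local Notation size Y := (cnt Y (F a)).

Definition fat Y := exists P k d s, [/\ nonstandard P, s <= P ^ k & spread F a P Y d s].

Lemma fat_definable Y : fat Y -> definable1 Y.
Proof. by move=> [P [k [d [s [_ _ []]]]]]. Qed.

Lemma fat_size n Y : fat Y -> n%:R < size Y.
Proof.
move=> [P [k [d [s [nP _ spreadY]]]]]; have s0 := spread_gt0 spreadY.
have [_ _ _ /(_ n)] := spreadY; have P1 := nonstandard_gt1 nP.
have sP : 1 <= s * P by pa_nra.
by have := pa_mul_le n%:R sP => *; pa_lra.
Qed.

Lemma fat_nonempty Y : fat Y -> Y !=set0.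
Proof.
move=> fatY; have [y [_ Yy]] := cnt_gt0 (fat_definable fatY) (fat_size 0 fatY).
by exists y.
Qed.

Lemma fat_not_subset1 Y x : fat Y -> ~ Y `<=` [set x].
Proof.
move=> fatY Yx; have := fat_size 1 fatY; have := cnt_set1 x (F a).
have : size Y <= size [set x]; last by rewrite /= => *; pa_lra.
by apply: cnt_le => [||y _ /Yx //]; [exact: fat_definable|solve_definable].
Qed.

Lemma fat_half Y Z :
  fat Y -> definable1 Z -> Z `<=` Y -> size Y <= 2%:R * size Z -> fat Z.
Proof.
move=> [P [k [d [s [nP s_Pk [_ dsa Yds sP]]]]]] defZ ZY YZ.
exists P, k, d, s; split=> //.
by split=> // [y /ZY /Yds //|]; exact: negligible_scale sP YZ.
Qed.

Lemma fat_avoids g L R : definable_fun g -> gap L R -> dense fat (avoids g L R).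
Proof.
move=> def_g gapLR Y fatY; have defY := fat_definable fatY.
have [|||A [defA halfA avA]] := @split_avoids (fun Z => size Y <= 2%:R * size Z)
    g Y L R def_g gapLR.
- by rewrite /=; pa_lra.
- move=> v; pose B := Y `&` [set y | g y <= v]; pose C := Y `&` [set y | v < g y].
  have defB : definable1 B by solve_definable.
  have defC : definable1 C by solve_definable.
  have Y_BC : size Y <= size B + size C.
    by apply: cnt_le_add => // y _ Yy; case: (pa_leP (g y) v); [left|right].
  by have [BC|CB] := pa_leP (size B) (size C); [right|left]; rewrite -/B -/C /=; pa_lra.
- by solve_definable.
exists (Y `&` A); split=> //; apply: fat_half halfA => //; by solve_definable.
Qed.

Lemma fat_separated g : definable_fun g -> dense fat (separated F a g).
Proof.
move=> def_g Y [P [k [d [s [nP s_Pk spreadY]]]]]; have [q [qP Pq]] := pa_sqrtP P.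
have nq := nonstandard_sqrt nP Pq; have q1 := nonstandard_gt1 nq.
have s_q : s <= q ^ (4 * k).
  rewrite powerM; apply: pa_le_trans s_Pk _; apply: power_le; exact: power4_ge.
have spread_qq : spread F a (q * q) Y d s.
  have [defY dsa Yds sP] := spreadY; split=> //; apply: negligible_le sP.
  exact: pa_mul_le.
have [d1 [s1 [Y1 [spreadY1 Y1Y s1_le sepY1]]]] :=
  spread_separable def_g nq spread_qq s_q.
exists Y1; split=> //; exists q, (4 * k)%N, d1, s1; split=> //.
exact: pa_le_trans s1_le s_q.
Qed.

Lemma fat_full P k :
  F 0 = 0 -> nonstandard P -> a <= P ^ k -> negligible (a * P) (F a) ->
  fat [set y | y < F a].
Proof.
move=> F0 nP a_Pk aP; have def_below : definable1 [set y | y < F a] by solve_definable.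
exists P, k, 0, a; split=> //; split=> //; first by rewrite pa_add0r; exact: pa_le_refl.
  by move=> y yF; rewrite F0 pa_add0r; split=> //; exact: pa_ge0.
by rewrite cnt_all.
Qed.

End Conditions.

Section NotE3.
Variable K : peano.
Implicit Types (a b c q P : K).

Lemma nonstandard_base c n : (forall m, m%:R < c ^ n) -> nonstandard c.
Proof.
move=> nstd; apply/nonstandardP => -[m _ cE].
by have := nstd (m ^ n)%N; rewrite -cE power_numeral; apply: pa_le_gtF;
  exact: pa_le_refl.
Qed.

Lemma not_E3_quotient a b : a < b -> ~ E3 a b ->
  exists q n, [/\ 1 <= q, a * q <= b & a <= (q + 1) ^ n].
Proof.
move=> ab nE; have [a0|a0] := pa_leP a 0.
  by exists 1, 0%N; split; rewrite /=; pa_lra.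
have [q [aq_b b_aq]] := pa_divP b a0.
have q1 : 1 <= q.
  by case: (pa_cases q) b_aq => [->|[q' ->]] b_aq; [exfalso|]; pa_lra.
exists q; apply: contrapT => /forallNP big; apply: nE; exists (q + 1); split.
  move=> n; have an : (q + 1) ^ n < a.
    by case: (pa_leP a ((q + 1) ^ n)) => // a_le; case: (big n).
  by split=> //; pa_lra.
by split=> //; have := pa_mul_le b q1 => ?; pa_lra.
Qed.

Lemma not_E3_negligible a b : nonstandard a -> a < b -> ~ E3 a b ->
  exists P k, [/\ nonstandard P, a <= P ^ k & negligible (a * P) b].
Proof.
move=> na ab nE; have [q [n [q1 aq_b a_q]]] := not_E3_quotient ab nE.
have nq1 : nonstandard (q + 1).
  by apply: (@nonstandard_base _ n) => m; have := na m => ?; pa_lra.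
have nq : nonstandard q by move=> m; have := nq1 m.+1 => /= ?; pa_lra.
have [P [Pq qP]] := pa_sqrtP q; have nP := nonstandard_sqrt nq qP.
have P1 := nonstandard_gt1 nP; exists P, (6 * n)%N; split=> // [|m].
  rewrite powerM; apply: pa_le_trans a_q _; apply: power_le.
  have q_P4 := power4_ge P1 qP; have PP2 : 2%:R <= P * P by rewrite /=; pa_nra.
  have -> : P ^ 6 = P ^ 4 * (P * P) by rewrite /=; pa_ring.
  by have := pa_mul_le (P ^ 4) PP2; move: (P ^ 4) q_P4 => p q_p /= *; pa_lra.
have mP_q : m%:R * P + 1 <= q by have := nP m => ?; pa_nra.
have a0 := na 0%N; have := pa_mul_le a mP_q; rewrite /= in a0.
by move: m%:R => *; pa_lra.
Qed.

End NotE3.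

(** * Generic filters and definable ultrapowers *)

Lemma rasiowa_sikorski (T : Type) (C : set (set T)) (D : set (set (set T)))
    (Y0 : set T) :
  countable D -> C Y0 -> (forall Y, C Y -> Y !=set0) -> (forall Q, D Q -> dense C Q) ->
  exists U : set_system T, [/\ ProperFilter U, U Y0,
    forall A, U A -> exists2 Y, C Y & Y `<=` A & forall Q, D Q -> exists2 Y, U Y & Q Y].
Proof.
move=> /countable_injP [code code_inj] CY0 C_ne denseD.
pose next (s s' : nat * {Y | C Y}) := [/\ s'.1 = s.1.+1, sval s'.2 `<=` sval s.2 &
  forall Q, D Q -> code Q = s.1 -> Q (sval s'.2)].
have next_ex s : {s' | next s s'}.
  apply: cid; case: s => n [Y CY].
  have [[Q DQ Qn]|none] := pselect (exists2 Q, D Q & code Q = n).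
    have [Y' [CY' Y'Y QY']] := denseD Q DQ Y CY.
    exists (n.+1, exist _ Y' CY'); split=> //= Q' DQ' Q'n.
    by rewrite (code_inj Q' Q) ?inE // Qn.
  by exists (n.+1, exist _ Y CY); split=> //= Q DQ Qn; case: none; exists Q.
have [s [s0 sS]] := dependent_choice next_ex (0%N, exist _ Y0 CY0).
pose Ys n := sval (s n).2.
have s_index n : (s n).1 = n.
  by elim: n => [|n IH]; [rewrite s0|have [-> _ _] := sS n; rewrite IH].
have Ys_le m n : (m <= n)%N -> Ys n `<=` Ys m.
  move=> /subnK <-; elim: (n - m)%N => // i; apply: subset_trans.
  by have [_ sub _] := sS (i + m)%N.
have CYs n : C (Ys n) := svalP (s n).2.
exists (filter_from setT Ys); split.
- apply: filter_from_proper => [|n _]; last exact: C_ne.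
  apply: filter_fromT_filter => [|m n]; first by exists 0%N.
  by exists (maxn m n) => y Ymn; split; apply: Ys_le Ymn; rewrite (leq_maxl, leq_maxr).
- by exists 0%N => //; rewrite /Ys s0.
- by move=> A [n _ YnA]; exists (Ys n).
move=> Q DQ; exists (Ys (code Q).+1); first by exists (code Q).+1.
by have [_ _ Q_next] := sS (code Q); apply: Q_next; rewrite ?s_index.
Qed.

Lemma definable_skolem (K : peano) (R : K -> K -> Prop) : definable2 R ->
  exists g, definable_fun g /\ forall y, (exists x, R y x) -> R y (g y).
Proof.
move=> defR; pose G y z := (R y z /\ forall w, w < z -> ~ R y w) \/
  ((~ exists x, R y x) /\ z = 0).
have G_ex y : exists z, G y z.
  have [Ry|none] := pselect ([set x | R y x] !=set0); last by exists 0; right.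
  have [|z [Ryz least_z]] := @pa_least K [set x | R y x] _ Ry; last by exists z; left.
  by solve_definable.
have G_uniq y z z' : G y z -> G y z' -> z = z'.
  move=> [[Rz least_z]|[none ->]] [[Rz' least_z']|[none' ->]] //.
  - by apply: contrapT => /pa_neq_lt [/least_z'|/least_z].
  - by case: none'; exists z.
  - by case: none; exists z'.
have [g gP] := choice G_ex; exists g; split; last first.
  by move=> y Ry; case: (gP y) => [[]//|[]].
apply: (@definable_ext _ (fun e => G (e 1%N) (e 0%N))) => [e|]; last first.
  by rewrite /G; solve_definable.
by split=> [Ge|->]; [exact: G_uniq Ge (gP _)|exact: gP].
Qed.

Record definable_ultrafilter (K : structure) := DefinableUltrafilter {
  ultra_sets :> set K -> Prop;
  ultra_proper : ProperFilter ultra_sets;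
  ultra_decides : forall A, definable1 A -> ultra_sets A \/ ultra_sets (~` A) }.

#[local] Existing Instance ultra_proper.

Section Ultrapower.
Variables (K : peano) (U : definable_ultrafilter K).

Definition definable_map : Type := {g : K -> K | definable_fun g}.
HB.instance Definition _ := gen_eqMixin definable_map.
HB.instance Definition _ := gen_choiceMixin definable_map.

Definition ultra_eq (g h : definable_map) : bool :=
  `[< U [set y | sval g y = sval h y] >].

Lemma ultra_eq_refl : reflexive ultra_eq.
Proof. by move=> g; apply/asboolP; exact: filterE. Qed.

Lemma ultra_eq_sym : symmetric ultra_eq.
Proof. by move=> g h; apply/asboolP/asboolP; apply: filterS => y /=. Qed.

Lemma ultra_eq_trans : transitive ultra_eq.
Proof.
move=> h g k /asboolP gh /asboolP hk; apply/asboolP.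
by apply: filterS2 gh hk => y /= -> ->.
Qed.

Canonical ultra_equiv := EquivRel ultra_eq ultra_eq_refl ultra_eq_sym ultra_eq_trans.

Definition ultra_carrier : Type := {eq_quot ultra_eq}%qT.
HB.instance Definition _ : EqQuotient _ ultra_eq ultra_carrier :=
  EqQuotient.on ultra_carrier.

Implicit Types u v : ultra_carrier.

Definition germ (g : K -> K) (def_g : definable_fun g) : ultra_carrier :=
  (\pi_ultra_carrier (exist _ g def_g : definable_map))%qT.

Definition germ_rep u : K -> K := sval (repr u).

Lemma definable_germ_rep u : definable_fun (germ_rep u).
Proof. exact: svalP (repr u). Qed.

Lemma germ_eqP (g h : definable_map) : reflect (U [set y | sval g y = sval h y])
  (\pi_ultra_carrier g == \pi_ultra_carrier h)%qT.
Proof. by rewrite eqmodE; exact: asboolP. Qed.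

Lemma germ_repE (g : K -> K) (def_g : definable_fun g) :
  U [set y | germ_rep (germ def_g) y = g y].
Proof. by apply/(germ_eqP (repr _) (exist _ g def_g)); rewrite reprK. Qed.

Lemma germ_rep_eqP u v : u = v <-> U [set y | germ_rep u y = germ_rep v y].
Proof.
split=> [->|uv]; first exact: filterE.
by apply/eqP; rewrite -[u]reprK -[v]reprK; apply/germ_eqP.
Qed.

Lemma definable_fun_const (k : K) : definable_fun (fun _ : K => k).
Proof. by solve_definable. Qed.

Lemma definable_fun_id : definable_fun (fun y : K => y).
Proof. by solve_definable. Qed.

Lemma definable_germ_rep_add u v : definable_fun (fun y => germ_rep u y + germ_rep v y).
Proof.
by have def_u := definable_germ_rep u; have def_v := definable_germ_rep v;
  solve_definable.
Qed.

Lemma definable_germ_rep_mul u v : definable_fun (fun y => germ_rep u y * germ_rep v y).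
Proof.
by have def_u := definable_germ_rep u; have def_v := definable_germ_rep v;
  solve_definable.
Qed.

Definition ultra_structure : structure := {|
  carrier := ultra_carrier;
  zero := germ (definable_fun_const 0);
  one := germ (definable_fun_const 1);
  lt := fun u v => U [set y | germ_rep u y < germ_rep v y];
  add := fun u v => germ (definable_germ_rep_add u v);
  mul := fun u v => germ (definable_germ_rep_mul u v) |}.

Lemma germ_rep_teval (e : nat -> ultra_structure) t :
  U [set y | germ_rep (teval e t) y = teval (fun i => germ_rep (e i) y) t].
Proof.
elim: t => [n|||t1 IH1 t2 IH2|t1 IH1 t2 IH2] /=.
- exact: filterE.
- exact: germ_repE.
- exact: germ_repE.
- have := germ_repE (definable_germ_rep_add (teval e t1) (teval e t2)).
  by apply: filterS3 IH1 IH2 => y /= <- <-.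
- have := germ_repE (definable_germ_rep_mul (teval e t1) (teval e t2)).
  by apply: filterS3 IH1 IH2 => y /= <- <-.
Qed.

Lemma definable_sat_germ_rep (e : nat -> ultra_structure) p :
  definable1 [set y | sat (fun i => germ_rep (e i) y) p].
Proof.
apply: (definable_sat p (T := fun i e' => germ_rep (e i) (e' 0%N))) => i.
by have def_i := definable_germ_rep (e i); solve_definable.
Qed.

Lemma ultra_not A : definable1 A -> U (~` A) <-> ~ U A.
Proof.
move=> defA; split=> [nA UA|nUA]; last by case: (ultra_decides U defA).
by have [y []] := filter_ex (filterI UA nA).
Qed.

Lemma germ_rep_env_cons (u : ultra_structure) (e : nat -> ultra_structure) y :
  (fun i => germ_rep (env_cons u e i) y) =
  env_cons (germ_rep u y) (fun i => germ_rep (e i) y).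
Proof. by apply/funext => -[]. Qed.

(* A definable Skolem function for a failing instance provides the germ at which
   the universal formula fails. *)
Lemma ultra_all (e : nat -> ultra_structure) p :
  (forall (g : K -> K) (def_g : definable_fun g),
    U [set y | sat (env_cons (germ_rep (germ def_g) y)
     (fun i => germ_rep (e i) y)) p]) ->
  U [set y | sat (fun i => germ_rep (e i) y) (fAll p)].
Proof.
move=> inst; apply: contrapT => /(ultra_not (definable_sat_germ_rep e (fAll p))) Ufail.
pose R y x := ~ sat (env_cons x (fun i => germ_rep (e i) y)) p.
have [g [def_g gP]] :
  exists g, definable_fun g /\ forall y, (exists x, R y x) -> R y (g y).
  apply: definable_skolem; apply: definable_not.
  pose T i (e' : nat -> K) := if i is j.+1 then germ_rep (e j) (e' 0%N) else e' 1%N.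
  apply: (definable_ext (S := fun e' => sat (fun i => T i e') p)) => [e'|].
    by rewrite (_ : (fun i => T i e') =
      env_cons (e' 1%N) (fun i => germ_rep (e i) (e' 0%N))) //;
      apply/funext => -[].
  apply: definable_sat => -[|i]; first exact: definable_term_var.
  by have def_i := definable_germ_rep (e i); rewrite /T; solve_definable.
have [y [[/= fail_y sat_y] g_y]] :=
  filter_ex (filterI (filterI Ufail (inst g def_g)) (germ_repE def_g)).
by case/existsNP: fail_y => x /(ex_intro (R y)) /gP; apply; rewrite -g_y.
Qed.

Lemma los p (e : nat -> ultra_structure) :
  sat e p <-> U [set y | sat (fun i => germ_rep (e i) y) p].
Proof.
elim: p e => [|t1 t2|t1 t2|p IHp q IHq|p IHp] e /=.
- by split=> // /filter_ex [].
- rewrite germ_rep_eqP.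
  by split; apply: filterS3 (germ_rep_teval e t1) (germ_rep_teval e t2) => y /= -> ->.
- by split; apply: filterS3 (germ_rep_teval e t1) (germ_rep_teval e t2) => y /= -> ->.
- rewrite IHp IHq; split=> [Upq|Upq Up]; last by apply: filterS2 Upq Up => y; apply.
  by have [/Upq|] := ultra_decides U (definable_sat_germ_rep e p);
    apply: filterS => y //= np /np.
- split=> [sat_p|Up u].
    by apply: ultra_all => g def_g; have /IHp := sat_p (germ def_g);
      apply: filterS => y; rewrite /= germ_rep_env_cons.
  by apply/IHp; apply: filterS Up => y /(_ (germ_rep u y)); rewrite -germ_rep_env_cons.
Qed.

Lemma ultra_PA : PA_model ultra_structure.
Proof. by move=> p pa_p e; apply/los; apply: filterE => y; exact: peano_axioms. Qed.

Definition ultrapower : peano := Peano ultra_PA.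

Definition const_germ (k : K) : ultrapower := germ (definable_fun_const k).
Definition generic_germ : ultrapower := germ definable_fun_id.

Lemma const_germ_elementary : elementary_embedding const_germ.
Proof.
move=> p e; rewrite los; have [n loc] := sat_local p.
have U_agree : U [set y | agree_below n (fun i => germ_rep (const_germ (e i)) y) e].
  elim: n {loc} => [|n IH]; first exact: filterE.
  apply: filterS2 IH (germ_repE (definable_fun_const (e n))) => y IH en i.
  by rewrite ltnS leq_eqVlt => /orP [/eqP ->|/IH].
split=> sat_p; first by apply: filterS U_agree => y /loc agree; apply/agree.
by have [y [/loc agree sat_y]] := filter_ex (filterI U_agree sat_p); apply/agree.
Qed.

Lemma ultrapower_countable : countable [set: K] -> countable [set: ultrapower].
Proof.
move=> /countable_definable_fun /countable_injP [code code_inj].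
apply/countable_injP; exists (code \o germ_rep) => u v _ _ /= uv.
apply/germ_rep_eqP; apply: filterE => y.
by rewrite (code_inj (germ_rep u) (germ_rep v)) ?inE //; exact: definable_germ_rep.
Qed.

Lemma ultra_le (u v : ultrapower) : U [set y | germ_rep u y <= germ_rep v y] -> u <= v.
Proof.
move=> u_le_v; case: (pa_leP u v) => // v_lt_u.
by have [y [/pa_le_gtF]] := filter_ex (filterI u_le_v v_lt_u).
Qed.

Lemma ultra_le_const (u : ultrapower) k Y :
  U Y -> (forall y, Y y -> germ_rep u y <= k) -> u <= const_germ k.
Proof.
move=> UY u_le; apply: ultra_le.
by apply: filterS2 UY (germ_repE (definable_fun_const k)) => y /u_le u_k /= ->.
Qed.

Lemma ultra_const_le (u : ultrapower) k Y :
  U Y -> (forall y, Y y -> k <= germ_rep u y) -> const_germ k <= u.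
Proof.
move=> UY le_u; apply: ultra_le.
by apply: filterS2 UY (germ_repE (definable_fun_const k)) => y /le_u k_u /= ->.
Qed.

Lemma generic_lt_const k Y : U Y -> (forall y, Y y -> y < k) ->
  generic_germ < const_germ k.
Proof.
by move=> UY Yk; apply: filterS3 UY (germ_repE definable_fun_id)
  (germ_repE (definable_fun_const k)) => y /Yk yk /= -> ->.
Qed.

Lemma const_lt_generic k Y : U Y -> (forall y, Y y -> k < y) ->
  const_germ k < generic_germ.
Proof.
by move=> UY Yk; apply: filterS3 UY (germ_repE definable_fun_id)
  (germ_repE (definable_fun_const k)) => y /Yk yk /= -> ->.
Qed.

Lemma generic_eq_const k : generic_germ = const_germ k -> U [set k].
Proof.
move=> /germ_rep_eqP.
by apply: filterS3 (germ_repE definable_fun_id)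
  (germ_repE (definable_fun_const k)) => y /= -> ->.
Qed.

End Ultrapower.

(** * One-step extensions *)

Section Extensions.
Variable K : peano.
Hypothesis K_countable : countable [set: K].
Implicit Types (G : set (set K * set K)) (C : set (set K)) (Y : set K).

Lemma gap_zero_one : gap [set (0 : K)] [set 1].
Proof.
split=> [|z]; first by exists 1.
by case: (pa_cases z) => [->|[w ->]]; [left; exists 0|right; exists 1] => //; pa_lra.
Qed.

Lemma definable_indicator (A : set K) : definable1 A ->
  exists g : K -> K, [/\ definable_fun g, forall y, g y <= 0 -> A y &
    forall y, 1 <= g y -> ~ A y].
Proof.
move=> defA; exists (fun y => if `[< A y >] then 0 else 1); split=> [|y|y].
- by solve_definable.
- by case: asboolP => // nAy one_le; exfalso; pa_lra.
- by case: asboolP => // Ay one_le; exfalso; pa_lra.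
Qed.

Definition preserves_gaps (K' : structure) (h : K -> K') G :=
  forall c, G c -> gap (h @` c.1) (h @` c.2).

Lemma generic_ultrapower C (Q : (K -> K) -> set (set K)) (Y0 : set K) G :
  C Y0 -> (forall Y, C Y -> Y !=set0) ->
  (forall g L R, definable_fun g -> gap L R -> dense C (avoids g L R)) ->
  (forall g, definable_fun g -> dense C (Q g)) ->
  countable G -> (forall c, G c -> gap c.1 c.2) ->
  exists U : definable_ultrafilter K, [/\ preserves_gaps (@const_germ K U) G, U Y0,
    forall A, U A -> exists2 Y, C Y & Y `<=` A &
    forall g, definable_fun g -> exists2 Y, U Y & Q g Y].
Proof.
move=> CY0 C_ne C_avoids C_Q G_countable G_gap.
pose funs := [set g : K -> K | definable_fun g].
have funs_countable : countable funs by exact: countable_definable_fun.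
pose G' := ([set ([set 0], [set 1])] : set (set K * set K)) `|` G.
have G'_gap c : G' c -> gap c.1 c.2 by case=> [->|/G_gap //]; exact: gap_zero_one.
pose D := [set avoids gc.1 gc.2.1 gc.2.2 | gc in funs `*` G'] `|` (Q @` funs).
have D_countable : countable D.
  apply: countable_setU; apply: countable_image => //; apply: countableX => //.
  by apply: countable_setU => //; exact: countable1.
have D_dense P : D P -> dense C P.
  by move=> [[[g c] [/= def_g /G'_gap gap_c] <-]|[g def_g <-]];
    [exact: C_avoids|exact: C_Q].
have [U [U_proper UY0 UC UD]] := rasiowa_sikorski D_countable CY0 C_ne D_dense.
have U_avoids g c : definable_fun g -> G' c -> exists2 Y, U Y & avoids g c.1 c.2 Y.
  by move=> def_g G'c; apply: UD; left; exists (g, c).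
have U_decides A : definable1 A -> U A \/ U (~` A).
  move=> /definable_indicator [g [def_g le0 ge1]].
  have [|Y UY] := U_avoids g ([set 0], [set 1]) def_g; first by left.
  by move=> [[_ -> Yg]|[_ -> Yg]]; [left|right]; apply: filterS UY => y /Yg;
    [exact: le0|exact: ge1].
pose U' := DefinableUltrafilter U_proper U_decides.
exists U'; split=> // [c Gc|g def_g]; last first.
  by apply: UD; right; exists g.
have [[r Rr] _] := G_gap c Gc; split=> [|z]; first by exists (const_germ U' r), r.
have [|Y UY] := U_avoids _ c (definable_germ_rep z); first by right.
move=> [[l Ll Yl]|[r' Rr' Yr']]; [left|right].
  by exists (const_germ U' l); [exists l|exact: (ultra_le_const (U := U') UY Yl)].
by exists (const_germ U' r'); [exists r'|exact: (ultra_const_le (U := U') UY Yr')].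
Qed.

Variable G : set (set K * set K).
Hypotheses (G_countable : countable G) (G_gap : forall c, G c -> gap c.1 c.2).

Definition good_extension (K' : peano) (h : K -> K') :=
  [/\ countable [set: K'], elementary_embedding h, preserves_gaps h G &
      exists y, forall k, y <> h k].

Lemma good_const_germ (U : definable_ultrafilter K) :
  preserves_gaps (@const_germ K U) G -> (forall k, ~ U [set k]) ->
  good_extension (@const_germ K U).
Proof.
move=> U_gaps U_free; split=> //.
- exact: ultrapower_countable.
- exact: const_germ_elementary.
- by exists (generic_germ U) => k /generic_eq_const /U_free.
Qed.

Lemma proper_extension : exists (K' : peano) (h : K -> K'), good_extension h.
Proof.
have [||||U [U_gaps _ U_unb _]] :=
  @generic_ultrapower (@unbounded K) (fun _ _ => True) setT G _ _ _ _ G_countable G_gap.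
- split; first by solve_definable.
  by move=> x; exists (x + 1); split=> //; pa_lra.
- by move=> Y [_ /(_ 0) [y []]]; exists y.
- exact: unbounded_avoids.
- by move=> g _ Y unbY; exists Y; split.
exists (ultrapower U), (const_germ U).
apply: good_const_germ => // k /U_unb [Y [_ unbY] Yk].
by have [y [/Yk ->]] := unbY k; apply: pa_le_gtF; exact: pa_le_refl.
Qed.

Definition left_of (K' : structure) (a : K) (F : K -> K') (y : K') : set K :=
  [set x | x <= a /\ F x < y].
Definition right_of (K' : structure) (a : K) (F : K -> K') (y : K') : set K :=
  [set x | x <= a /\ y < F x].

Lemma separating_extension (F : K -> K) (a : K) :
  F 0 = 0 -> nonstandard a -> a < F a -> ~ E3 a (F a) ->
  exists (K' : peano) (h : K -> K'), good_extension h /\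
    exists y, y < h (F a) /\
      gap (h @` left_of a (h \o F) y) (h @` right_of a (h \o F) y).
Proof.
move=> F0 na a_Fa nE; have [P [k [nP a_Pk aP]]] := not_E3_negligible na a_Fa nE.
have [||||U [U_gaps U_below U_fat U_sep]] :=
  @generic_ultrapower (fat F a) (separated F a)
  [set y | y < F a] G _ _ _ _ G_countable G_gap.
- exact: fat_full a_Pk aP.
- exact: fat_nonempty.
- exact: fat_avoids.
- exact: fat_separated.
exists (ultrapower U), (const_germ U); split.
  by apply: good_const_germ => // x /U_fat [Y fatY]; exact: (fat_not_subset1 fatY).
have y_lt : generic_germ U < const_germ U (F a) by apply: generic_lt_const U_below _.
exists (generic_germ U); split=> //; split=> [|z].
  by exists (const_germ U a), a => //; split=> //; exact: pa_le_refl.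
have [Y UY [x xa [sepY|sepY]]] := U_sep _ (definable_germ_rep z); [left|right].
  exists (const_germ U x); first exists x => //.
    by split=> //; apply: const_lt_generic UY _ => y /sepY [].
  by apply: ultra_le_const UY _ => y /sepY [].
exists (const_germ U x); first exists x => //.
  by split=> //; apply: generic_lt_const UY _ => y /sepY [].
by apply: ultra_const_le UY _ => y /sepY [].
Qed.

End Extensions.

(** * Order isomorphisms, and the inclusion of E3 in E5 *)

Section OrderIsomorphisms.
Variable K : peano.
Implicit Types x y a b : K.

Lemma E3_sym a b : E3 a b -> E3 b a.
Proof.
by move=> [c [small_c [ab ba]]]; exists c; split=> // n; have [] := small_c n.
Qed.

Lemma E3_refl a : nonstandard a -> E3 a a.
Proof.
move=> na; exists 2%:R; split=> [n|]; first by rewrite power_numeral; split; exact: na.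
by have := na 0%N => /= a0; split; pa_lra.
Qed.

Lemma order_iso_of_increasing (f : K -> K) : (forall x y, x < y -> f x < f y) ->
  (forall z, exists x, f x = z) -> order_iso setT setT f.
Proof.
move=> f_mono f_surj; split=> [|x y _ _]; last first.
  split=> [/f_mono //|fxy]; case: (pa_leP y x) => // yx; exfalso.
  have [E|/(pa_le_neq_lt yx)/f_mono] := pselect (y = x); last by move=> ?; pa_lra.
  by rewrite E in fxy; pa_lra.
split=> // [x y _ _ fxy|z _]; last by have [x xz] := f_surj z; exists x.
by apply: contrapT => /pa_neq_lt [] /f_mono; rewrite fxy => ?; pa_lra.
Qed.

Lemma order_iso_inverse a b (f : K -> K) :
  order_iso (below (@lt K) a) (below (@lt K) b) f ->
  exists g, order_iso (below (@lt K) b) (below (@lt K) a) g.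
Proof.
move=> [[f_fun f_inj f_surj] f_lt].
have /choice [g gP] y : exists x, y < b -> x < a /\ f x = y.
  have [/f_surj [x xa fx]|] := pselect (y < b); first by exists x.
  by exists y.
exists g; split; first split.
- by move=> y /= /gP [].
- by move=> y y'; rewrite !inE /= => /gP [_ {2}<-] /gP [_ {2}<-] ->.
- move=> x xa; have fxb : f x < b := f_fun x xa; exists (f x) => //.
  by have [gfx_a fgf] := gP _ fxb; apply: f_inj; rewrite ?inE.
- by move=> y y' /gP [gya fgy] /gP [gya' fgy']; rewrite (f_lt (g y)) // fgy fgy'.
Qed.

Lemma E5_order_iso_below a b :
  E5 a b -> exists f, order_iso (below (@lt K) a) (below (@lt K) b) f.
Proof.
move=> [f [[[_ f_inj f_surj] f_lt] <-]]; exists f; split; first split.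
- by move=> x /= xa; rewrite /below /= -f_lt.
- by move=> x y _ _; apply: f_inj; rewrite inE.
- move=> y /= y_fa; have [x _ xy] := f_surj y I; exists x => //.
  by rewrite /below /= f_lt // xy.
- by move=> x y _ _; apply: f_lt.
Qed.

Lemma order_iso_below_extension a b (g : K -> K) : 0 < a ->
  order_iso (below (@lt K) a) (below (@lt K) b) g -> exists F : K -> K,
  [/\ F 0 = 0, F a = b, forall x y, x < y -> y <= a -> F x < F y &
      forall y, y < b -> exists2 x, x <= a & F x = y].
Proof.
move=> a0 [[g_fun g_inj g_surj] g_lt]; pose F x := if pselect (x = a) then b else g x.
have Fa : F a = b by rewrite /F; case: pselect.
have Fg x : x < a -> F x = g x.
  by rewrite /F; case: pselect => //= {1}-> aa; exfalso; pa_lra.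
have F_mono x y : x < y -> y <= a -> F x < F y.
  move=> xy ya; have xa : x < a by pa_lra.
  rewrite (Fg x) //; have [->|/(pa_le_neq_lt ya) ya'] := pselect (y = a).
    by rewrite Fa; exact: g_fun.
  by rewrite (Fg y) // -g_lt.
have F_onto y : y < b -> exists2 x, x <= a & F x = y.
  by move=> /g_surj [x xa <-]; exists x; [exact: pa_ltW|exact: Fg].
exists F; split=> //; have b0 : 0 < b.
  by have F0a := F_mono 0 a a0 (pa_le_refl a); rewrite Fa in F0a; pa_lra.
have [x xa Fx] := F_onto 0 b0.
have [xE|/nesym/(pa_le_neq_lt (pa_ge0 x)) x0] := pselect (x = 0).
  by rewrite -{1}xE.
by have := F_mono 0 x x0 xa; rewrite Fx => ?; exfalso; pa_lra.
Qed.

Lemma increasing_le a (F : K -> K) : (forall x y, x < y -> y <= a -> F x < F y) ->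
  forall x y, x <= y -> y <= a -> F x <= F y.
Proof.
move=> F_mono x y xy ya; have [->|neq] := pselect (x = y); first exact: pa_le_refl.
by apply/pa_ltW/F_mono => //; exact: pa_le_neq_lt.
Qed.

End OrderIsomorphisms.

Section RigidTranslation.
Variables (K : peano) (a b c : K).
Hypothesis power_lt : forall n, c ^ n < a /\ c ^ n < b.
Hypothesis a_bc : a < b * c.
Hypothesis b_ac : b < a * c.
Implicit Types x y z i : K.

Lemma E3_left_gt0 : 0 < a. Proof. by have [] := power_lt 0 => /= *; pa_lra. Qed.

Lemma E3_right_gt0 : 0 < b. Proof. by have [] := power_lt 0 => /= *; pa_lra. Qed.

Lemma E3_witness_ge2 : 2%:R <= c.
Proof.
have ab : a < b * c := a_bc; have ba : b < a * c := b_ac.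
case: (pa_cases c) ab ba => [->|[d ->]]; first by move=> ? ?; pa_lra.
by case: (pa_cases d) => [->|[e ->]] ab ba; rewrite /=; pa_lra.
Qed.

Definition small x := exists n, x < c ^ n.

Lemma small_le x y : x <= y -> small y -> small x.
Proof. by move=> xy [n yn]; exists n; pa_lra. Qed.

Lemma small0 : small 0. Proof. by exists 0%N => /=; pa_lra. Qed.

Lemma small_mulc x : small x -> small (x * c).
Proof.
move=> [n xn]; exists n.+1 => /=; rewrite !(pa_mulC _ c).
by have := E3_witness_ge2; move: (c ^ n) xn => /= p xp c2; pa_nra.
Qed.

Lemma small_add x y : small x -> small y -> small (x + y).
Proof.
wlog xy : x y / x <= y => [wlog_xy small_x small_y|_ small_y].
  have [xy|/pa_ltW yx] := pa_leP x y; first exact: wlog_xy.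
  by rewrite pa_addC; exact: wlog_xy.
apply: (@small_le _ (y * c)); last exact: small_mulc.
by have := E3_witness_ge2; have y0 := pa_ge0 y => /= c2;
  have := pa_mul_le y c2 => ?; pa_lra.
Qed.

Lemma small1 : small 1.
Proof. by have := E3_witness_ge2 => /= c2; exists 1%N => /=; pa_lra. Qed.

Lemma not_small_a : ~ small a.
Proof. by move=> [n an]; have [/pa_ltW/pa_le_gtF] := power_lt n. Qed.

Definition close x y := exists i, [/\ small i, x <= y + i & y <= x + i].

Lemma close_refl x : close x x.
Proof. by exists 0; split; [exact: small0|pa_lra|pa_lra]. Qed.

Lemma close_sym x y : close x y -> close y x.
Proof. by move=> [i [small_i xy yx]]; exists i. Qed.

Lemma close_trans y x z : close x y -> close y z -> close x z.
Proof.
move=> [i [small_i xy yx]] [j [small_j yz zy]]; exists (i + j).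
by split; [exact: small_add|pa_lra|pa_lra].
Qed.

Definition scale x : K := sval (cid (pa_divP (x * b) E3_left_gt0)).

Lemma scaleP x : a * scale x <= x * b < a * (scale x + 1).
Proof. by rewrite /scale; case: cid. Qed.

Lemma scale_le x y i : x <= y + i -> scale x <= scale y + (1 + i * c).
Proof.
move=> x_yi; have [ax _] := scaleP x; have [_ ay] := scaleP y.
suff ? : scale x < scale y + (1 + i * c) by pa_lra.
apply: (@pa_mul_ltI _ _ _ a); have xb := pa_mul_le b x_yi.
by have ib := pa_mul_le i (pa_ltW b_ac); clear - ax ay xb ib; pa_lra.
Qed.

Lemma le_of_scale x y i : scale x <= scale y + i -> x <= y + (i + 1) * c.
Proof.
move=> x_yi; have [_ ax] := scaleP x; have [ay _] := scaleP y.
suff ? : x < y + (i + 1) * c by exact: pa_ltW.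
apply: (@pa_mul_ltI _ _ _ b); have xa := pa_mul_le a x_yi.
by have ia := pa_mul_le (i + 1) (pa_ltW a_bc); clear - ax ay xa ia; pa_lra.
Qed.

Lemma scale_close x y : close x y -> close (scale x) (scale y).
Proof.
move=> [i [small_i xy yx]]; exists (1 + i * c); split; try exact: scale_le.
by apply: small_add; [exact: small1|exact: small_mulc].
Qed.

Lemma scale0 : scale 0 = 0.
Proof. by have [a0 _] := scaleP 0; have := E3_left_gt0 => ?; pa_nra. Qed.

Lemma scale_a : scale a = b.
Proof.
have [a_le a_lt] := scaleP a.
have le_b : scale a <= b by apply: (pa_mul_leI E3_left_gt0); pa_lra.
have b_lt : b < scale a + 1 by apply: (@pa_mul_ltI _ _ _ a); pa_lra.
by pa_lra.
Qed.

Definition center x : K :=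
  if `[< close x 0 >] then 0 else if `[< close x a >] then a
  else xget (0 : {classic K}) (close x).

Lemma center_close x : close x (center x).
Proof.
rewrite /center; case: asboolP => // _; case: asboolP => // _.
by apply: xgetPex; exists x; exact: close_refl.
Qed.

Lemma center_eq x y : close x y -> center x = center y.
Proof.
move=> xy; suff E : close x = close y by rewrite /center E.
apply/funext => z; apply/propext.
by split; apply: close_trans => //; exact: close_sym.
Qed.

Lemma center_small x : small (center x) -> center x = 0.
Proof.
move=> small_x; rewrite /center; case: asboolP => // not_close; case: not_close.
apply: close_trans (center_close x) _; exists (center x); split=> //; pa_lra.
Qed.

Lemma center_a : center a = a.
Proof.
rewrite /center; case: asboolP => [[i [small_i a_i _]]|_].
  by case: not_small_a; apply: small_le small_i; rewrite pa_add0r in a_i.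
by case: asboolP => // -[]; exact: close_refl.
Qed.

Lemma center_large x i :
  small i -> center x = 0 \/ i <= center x /\ i <= scale (center x).
Proof.
move=> small_i; have [/center_small|large] := pselect (small (center x));
  [by left|right].
split; first by case: (pa_leP i (center x)) => // /pa_ltW /small_le /(_ small_i).
case: (pa_leP i (scale (center x))) => // /pa_ltW x_i; case: large.
have := @le_of_scale (center x) 0 i; rewrite scale0 !pa_add0r.
move=> /(_ x_i) /small_le; apply.
by apply: small_mulc; apply: small_add => //; exact: small1.
Qed.

Lemma translate_ex x : exists z, z + center x = scale (center x) + x.
Proof.
have [i [small_i x_i i_x]] := center_close x.
suff [z zE] : center x <= scale (center x) + x by exists z; rewrite pa_addC.
by have [->|[? ?]] := center_large x small_i; pa_lra.
Qed.

Definition translate x : K := sval (cid (translate_ex x)).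

Lemma translateP x : translate x + center x = scale (center x) + x.
Proof. by rewrite /translate; case: cid. Qed.

Lemma translate_lt x y : x < y -> translate x < translate y.
Proof.
move=> xy; have tx := translateP x; have ty := translateP y.
have [/center_eq E|not_close] := pselect (close x y); first by rewrite E in tx; pa_lra.
case: (pa_leP (translate y) (translate x)) => // tyx; case: not_close.
have [i [small_i x_i i_x]] := center_close x.
have [j [small_j y_j j_y]] := center_close y.
have cy_cx : scale (center y) <= scale (center x) + (i + j) by pa_lra.
have small_ij := small_add small_i small_j.
exists ((i + j + 1) * c + (i + j)); split.
- by apply: small_add => //; apply: small_mulc; apply: small_add => //; exact: small1.
- exact: pa_le_trans (pa_ltW xy) (pa_leDl _ _).
- by have := le_of_scale cy_cx => ?; pa_lra.
Qed.

Lemma scale_onto z : exists y, close (scale y) z.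
Proof.
have [y [y_le y_lt]] := pa_divP (z * a) E3_right_gt0; exists y.
have [ay_le ay_lt] := scaleP y; exists (1 + c); split.
- apply: small_add; first exact: small1.
  by rewrite -(pa_mul1r c); apply: small_mulc; exact: small1.
- by have : scale y <= z by [apply: (pa_mul_leI E3_left_gt0); pa_lra]; move=> ?; pa_lra.
- suff ? : z < scale y + (1 + c) by pa_lra.
  by apply: (@pa_mul_ltI _ _ _ a); have := b_ac; clear - y_lt ay_lt => *; pa_lra.
Qed.

Lemma translate_surj z : exists x, translate x = z.
Proof.
have [y y_z] := scale_onto z.
have [i [small_i y_i i_y]] :=
  close_trans (close_sym (scale_close (center_close y))) y_z.
have [x xE] : scale (center y) <= center y + z.
  by have [->|[? ?]] := center_large y small_i; rewrite ?scale0; pa_lra.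
have E : center x = center y.
  apply: center_eq; apply: close_trans (close_sym (center_close y)).
  by exists i; split=> //; pa_lra.
by exists x; have := translateP x; rewrite E => ?; pa_lra.
Qed.

Lemma translate_a : translate a = b.
Proof. by have := translateP a; rewrite center_a scale_a => ?; pa_lra. Qed.

End RigidTranslation.

Lemma E3_E5 (K : peano) (a b : K) : E3 a b -> E5 a b.
Proof.
move=> [c [power_lt [a_bc b_ac]]]; exists (translate power_lt a_bc b_ac); split.
  apply: order_iso_of_increasing; [exact: translate_lt|exact: translate_surj].
exact: translate_a.
Qed.

(** * Elementary embeddings and unions of directed families *)

Section ElementaryEmbedding.
Variables (K N : structure) (h : K -> N).
Hypothesis h_elem : elementary_embedding h.
Implicit Types x y z : K.

Lemma elementary_inj : injective h.
Proof. by move=> x y; apply: (h_elem (fEq (tVar 0) (tVar 1)) (nth 0 [:: x; y])).2. Qed.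

Lemma elementary_lt x y : x < y <-> h x < h y.
Proof. exact: (h_elem (fLt (tVar 0) (tVar 1)) (nth 0 [:: x; y])). Qed.

Lemma elementary_add x y : h (x + y) = h x + h y.
Proof.
exact/esym/(h_elem (fEq (tAdd (tVar 0) (tVar 1)) (tVar 2)) (nth 0 [:: x; y; x + y])).1.
Qed.

Lemma elementary_mul x y : h (x * y) = h x * h y.
Proof.
exact/esym/(h_elem (fEq (tMul (tVar 0) (tVar 1)) (tVar 2)) (nth 0 [:: x; y; x * y])).1.
Qed.

Lemma elementary0 : h 0 = 0.
Proof. by apply: (h_elem (fEq (tVar 0) tZero) (fun=> 0)).1. Qed.

Lemma elementary1 : h 1 = 1.
Proof. by apply: (h_elem (fEq (tVar 0) tOne) (fun=> 1)).1. Qed.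

Lemma elementary_pairing x y : h (pairing x y) = pairing (h x) (h y).
Proof. by rewrite /pairing !(elementary_add, elementary_mul). Qed.

Lemma elementary_numeral n : h n%:R = n%:R.
Proof.
by elim: n => [|n IH] /=; rewrite ?elementary0 // elementary_add IH elementary1.
Qed.

Lemma elementary_power x n : h (x ^ n) = h x ^ n.
Proof. by elim: n => [|n IH] /=; rewrite ?elementary1 // elementary_mul IH. Qed.

Lemma elementary_E3 x y : E3 x y -> E3 (h x) (h y).
Proof.
move=> [z [power_lt [xyz yxz]]]; exists (h z); split=> [n|].
  by rewrite -elementary_power -!elementary_lt.
by rewrite -!elementary_mul -!elementary_lt.
Qed.

Lemma elementary_nonstandard x : nonstandard (h x) -> nonstandard x.
Proof. by move=> nhx n; apply/elementary_lt; rewrite elementary_numeral. Qed.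

(* Apply [h] to the universal closure of [p]. *)
Lemma elementary_valid p :
  (forall e : nat -> K, sat e p) -> forall e : nat -> N, sat e p.
Proof.
move=> valid_p e; have [n loc] := sat_local p; pose e0 : nat -> K := fun=> 0.
have closure : sat e0 (iter n fAll p).
  elim: n {loc} p valid_p e0 => // n IH p valid_p e0.
  by rewrite iterSr; apply: IH => e' x; exact: valid_p.
move: closure => /h_elem; move: (h \o e0) => e1 closure.
pose splice k (e' : nat -> N) i := if (i < k)%N then e' i else e1 (i - k)%N.
suff : sat (splice n e) p by apply: iffLR; apply: loc => i i_n; rewrite /splice i_n.
elim: n {loc valid_p} p e closure => [|n IH] p e closure.
  by rewrite (_ : splice 0%N e = e1) //; apply/funext => i; rewrite /splice subn0.
rewrite iterSr in closure; have := IH _ (fun i => e i.+1) closure (e 0%N).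
by congr sat; apply/funext => -[|i].
Qed.

End ElementaryEmbedding.

Lemma elementary_le (K N : peano) (h : K -> N) x y :
  elementary_embedding h -> x <= y <-> h x <= h y.
Proof.
move=> h_elem; split=> [[z <-]|hxy]; first by rewrite elementary_add //; exists (h z).
by case: (pa_leP x y) => // /(elementary_lt h_elem) /pa_le_gtF.
Qed.

Lemma elementary_comp (K M N : structure) (h : K -> M) (g : M -> N) :
  elementary_embedding h -> elementary_embedding g -> elementary_embedding (g \o h).
Proof. by move=> h_elem g_elem p e; rewrite (h_elem p e) (g_elem p (h \o e)). Qed.

Section Labelled.
Variable W : Type.

(* The labels turn elementary embeddings into inclusions: a chain of labelled models
   has a union, and a set of labels can guess a subset of it. *)
Record labelled := Labelled {
  labelled_model :> peano;
  label : labelled_model -> W;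
  label_inj : injective label }.

Definition labels (A : labelled) : set W := range (@label A).

Definition label_embedding (A B : labelled) (i : A -> B) :=
  elementary_embedding i /\ forall x, label (i x) = label x.

Definition embeds (A B : labelled) := exists i : A -> B, label_embedding i.

Lemma label_embedding_comp (A B C : labelled) (i : A -> B) (j : B -> C) :
  label_embedding i -> label_embedding j -> label_embedding (j \o i).
Proof.
move=> [i_elem i_label] [j_elem j_label]; split; first exact: elementary_comp.
by move=> x /=; rewrite j_label i_label.
Qed.

Lemma label_embedding_eq (A B C : labelled) (i : A -> C) (j : B -> C) x y :
  label_embedding i -> label_embedding j -> label x = label y -> i x = j y.
Proof.
by move=> [_ i_label] [_ j_label] xy; apply: label_inj; rewrite i_label j_label.
Qed.

Lemma embeds_refl A : embeds A A.
Proof. by exists id. Qed.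

Lemma embeds_trans B A C : embeds A B -> embeds B C -> embeds A C.
Proof. by move=> [i i_emb] [j j_emb]; exists (j \o i); exact: label_embedding_comp. Qed.

Lemma embeds_labels A B : embeds A B -> labels A `<=` labels B.
Proof. by move=> [i [_ i_label]] _ [x _ <-]; exists (i x). Qed.

Definition is_union (Fam : labelled -> Prop) (U : labelled) :=
  (forall A, Fam A -> embeds A U) /\
  forall x : U, exists A, Fam A /\ labels A (label x).

Definition directed (Fam : labelled -> Prop) :=
  forall A B, Fam A -> Fam B -> exists C, [/\ Fam C, embeds A C & embeds B C].

Section Union.
Variables (Fam : labelled -> Prop) (A0 : labelled).
Hypotheses (Fam_A0 : Fam A0) (Fam_directed : directed Fam).

Definition union_carrier : Type := {w : W | exists A, Fam A /\ labels A w}.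

Definition union_in (A : labelled) (FA : Fam A) (x : A) : union_carrier :=
  exist _ (label x) (ex_intro _ A (conj FA (imageT _ x))).

Lemma union_in_eq (A B : labelled) (FA : Fam A) (FB : Fam B) (x : A) (y : B) :
  union_in FA x = union_in FB y <-> label x = label y.
Proof. by split=> [/(congr1 sval)|xy] //; apply: eq_exist. Qed.

Lemma union_in_surj (u : union_carrier) :
  exists A (FA : Fam A) (x : A), u = union_in FA x.
Proof.
by case: u => w Uw; have [A [FA [x _ xw]]] := Uw; exists A, FA, x; apply: eq_exist.
Qed.

Lemma union_in_common (u v : union_carrier) :
  exists A (FA : Fam A) (x y : A), u = union_in FA x /\ v = union_in FA y.
Proof.
have [A [FA [x ->]]] := union_in_surj u; have [B [FB [y ->]]] := union_in_surj v.
have [C [FC [i [_ i_label]] [j [_ j_label]]]] := Fam_directed FA FB.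
by exists C, FC, (i x), (j y); rewrite !union_in_eq.
Qed.

Lemma union_op_ex (op : forall A : structure, A -> A -> A) (u v : union_carrier) :
  exists w, exists A (FA : Fam A) (x y : A),
    [/\ u = union_in FA x, v = union_in FA y & w = union_in FA (op A x y)].
Proof.
have [A [FA [x [y [-> ->]]]]] := union_in_common u v.
by exists (union_in FA (op A x y)), A, FA, x, y.
Qed.

Definition union_op (op : forall A : structure, A -> A -> A) u v : union_carrier :=
  sval (cid (union_op_ex op u v)).

Definition union_structure : structure := {|
  carrier := union_carrier;
  zero := union_in Fam_A0 0;
  one := union_in Fam_A0 1;
  lt := fun u v => exists A (FA : Fam A) (x y : A),
    [/\ u = union_in FA x, v = union_in FA y & x < y];
  add := union_op (@add);
  mul := union_op (@mul) |}.

Lemma union_opE (op : forall A : structure, A -> A -> A) (A : labelled)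
    (FA : Fam A) (x y : A) :
  (forall (K N : structure) (h : K -> N), elementary_embedding h ->
     forall x y, h (op K x y) = op N (h x) (h y)) ->
  union_op op (union_in FA x) (union_in FA y) = union_in FA (op A x y).
Proof.
move=> op_elem; rewrite /union_op; case: cid => w /= [B [FB [x' [y' [xx' yy' ->]]]]].
have [C [FC [i i_emb] [j j_emb]]] := Fam_directed FA FB.
move: xx' yy' => /union_in_eq xx' /union_in_eq yy'; apply/union_in_eq.
rewrite -(i_emb.2 (op A x y)) -(j_emb.2 (op B x' y')).
rewrite (op_elem _ _ i i_emb.1) (op_elem _ _ j j_emb.1).
by rewrite (label_embedding_eq i_emb j_emb xx') (label_embedding_eq i_emb j_emb yy').
Qed.

Lemma union_in0 (A : labelled) (FA : Fam A) : union_in FA 0 = zero union_structure.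
Proof.
have [C [FC [i [i_elem i_label]] [j [j_elem j_label]]]] := Fam_directed FA Fam_A0.
by apply/union_in_eq; rewrite -i_label -j_label !elementary0.
Qed.

Lemma union_in1 (A : labelled) (FA : Fam A) : union_in FA 1 = one union_structure.
Proof.
have [C [FC [i [i_elem i_label]] [j [j_elem j_label]]]] := Fam_directed FA Fam_A0.
by apply/union_in_eq; rewrite -i_label -j_label !elementary1.
Qed.

Lemma union_in_lt (A : labelled) (FA : Fam A) (x y : A) :
  x < y <-> @lt union_structure (union_in FA x) (union_in FA y).
Proof.
split=> [xy|[B [FB [x' [y' [/union_in_eq xx' /union_in_eq yy' x'y']]]]]].
  by exists A, FA, x, y.
have [C [FC [i i_emb] [j j_emb]]] := Fam_directed FA FB.
apply/(elementary_lt i_emb.1); rewrite (label_embedding_eq i_emb j_emb xx').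
by rewrite (label_embedding_eq i_emb j_emb yy') -(elementary_lt j_emb.1).
Qed.

Lemma union_in_teval (A : labelled) (FA : Fam A) (e : nat -> A) t :
  teval (union_in FA \o e : nat -> union_structure) t = union_in FA (teval e t).
Proof.
elim: t => [n|||t1 IH1 t2 IH2|t1 IH1 t2 IH2] /=;
  rewrite ?IH1 ?IH2 ?union_in0 ?union_in1 //.
  by apply: union_opE => K N h h_elem x y; exact: elementary_add.
by apply: union_opE => K N h h_elem x y; exact: elementary_mul.
Qed.

Lemma union_in_elementary (A : labelled) (FA : Fam A) :
  elementary_embedding (union_in FA : A -> union_structure).
Proof.
move=> p; elim: p A FA => [|t1 t2|t1 t2|p IHp q IHq|p IHp] A FA e /=.
- by [].
- by rewrite !union_in_teval union_in_eq; split=> [->|/label_inj].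
- by rewrite !union_in_teval; exact: (union_in_lt FA).
- by rewrite -IHp -IHq.
have env_consE (B : labelled) (FB : Fam B) (x : B) (e' : nat -> B) :
    env_cons (union_in FB x) (union_in FB \o e') = union_in FB \o env_cons x e'.
  by apply/funext => -[].
split=> sat_p; last by move=> x; apply/(IHp A FA); rewrite -env_consE; apply: sat_p.
move=> u; have [B [FB [y ->]]] := union_in_surj u.
have [C [FC [i [i_elem i_label]] [j [_ j_label]]]] := Fam_directed FA FB.
have -> : union_in FB y = union_in FC (j y) by apply/union_in_eq.
have -> : union_in FA \o e = union_in FC \o (i \o e).
  by apply/funext => n /=; apply/union_in_eq.
rewrite env_consE -IHp; have /(i_elem (fAll p)) sat_all : sat e (fAll p) by [].
exact: sat_all.
Qed.

Lemma union_PA : PA_model union_structure.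
Proof.
move=> p pa_p; apply: (elementary_valid (union_in_elementary Fam_A0)).
exact: peano_axioms.
Qed.

Lemma union_ex : exists U, is_union Fam U.
Proof.
have sval_inj : injective (fun u : Peano union_PA => sval u).
  by move=> [w Uw] [w' Uw'] /= ww'; apply: eq_exist.
exists (@Labelled (Peano union_PA) _ sval_inj); split=> [A FA|u]; last exact: svalP u.
by exists (union_in FA); split=> //; exact: union_in_elementary.
Qed.

End Union.
End Labelled.

(** * Orders of type omega_1 *)

Lemma well_founded_choice (W V : Type) (R : W -> W -> Prop)
    (P : W -> (W -> V) -> Prop) (v0 : V) :
  well_founded R ->
  (forall l f g, (forall m, m = l \/ R m l -> f m = g m) -> P l f -> P l g) ->
  (forall l f, (forall m, R m l -> P m f) ->
     exists g, (forall m, R m l -> g m = f m) /\ P l g) ->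
  exists f, forall l, P l f.
Proof.
move=> wf local step.
pose extend l (rec : forall m, R m l -> V) m : V :=
  if pselect (R m l) is left ml then rec m ml else v0.
pose good l rec g := (forall m, R m l -> g m = extend l rec m) /\ P l g.
pose next l (rec : forall m, R m l -> V) : V :=
  if pselect (exists g, good l rec g) is left ex then sval (cid ex) l else v0.
pose f := Fix wf (fun=> V) next.
have fE l : f l = next l (fun m _ => f m).
  rewrite /f Fix_eq // => x u v uv; congr next.
  by apply/functional_extensionality_dep => m;
    apply/functional_extensionality_dep => mx.
exists f; elim/(well_founded_ind wf) => l IH; pose rec m (_ : R m l) := f m.
have extendE m : R m l -> extend l rec m = f m by rewrite /extend; case: pselect.
have good_ex : exists g, good l rec g.
  have [g [g_eq Pg]] := step l f IH; exists g; split=> // m ml.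
  by rewrite g_eq // extendE.
have [g [[g_eq Pg] flE]] : exists g, good l rec g /\ f l = g l.
  by rewrite fE /next; case: pselect => // ex; case: (cid ex) => g /=; exists g.
by apply: local Pg => m [->//|ml]; rewrite g_eq // extendE.
Qed.

Section Omega1.
Variables (W : Type) (R : W -> W -> Prop).
Hypothesis W_omega1 : omega1_order R.
Implicit Types (w v d : W) (S : set W).

Lemma omega1_wf : well_founded R. Proof. by case: W_omega1. Qed.

Lemma omega1_trans w v d : R w v -> R v d -> R w d.
Proof. by case: W_omega1 => _ trans _ _ _; exact: trans. Qed.

Lemma omega1_total w v : R w v \/ w = v \/ R v w.
Proof. by case: W_omega1 => _ _ total _ _; exact: total. Qed.

Lemma omega1_uncountable : ~ countable [set: W]. Proof. by case: W_omega1. Qed.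

Lemma omega1_countable_below w : countable (below R w).
Proof. by case: W_omega1 => _ _ _ _; apply. Qed.

Lemma omega1_irrefl w : ~ R w w.
Proof. by elim/(well_founded_ind omega1_wf): w => w IH ww; exact: (IH w ww ww). Qed.

Lemma omega1_countable_upto w : countable (below R w `|` [set w]).
Proof. by apply: countable_setU; [exact: omega1_countable_below|exact: countable1]. Qed.

Lemma omega1_least S : S !=set0 -> exists w, S w /\ forall v, R v w -> ~ S v.
Proof.
move=> [w Sw]; apply: contrapT => /forallNP no_least.
suff : ~ S w by []; elim/(well_founded_ind omega1_wf): w {Sw} => w IH Sw.
by apply: (no_least w); split=> // v; exact: IH.
Qed.

Lemma omega1_bounded S : countable S -> exists d, forall w, S w -> R w d.
Proof.
move=> S_countable; apply: contrapT => /forallNP unbounded; apply: omega1_uncountable.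
apply: (@sub_countable _ _ _ (\bigcup_(w in S) (below R w `|` [set w]))); last first.
  by apply: bigcup_countable => // w _; exact: omega1_countable_upto.
apply: subset_card_le => d _; have /existsNP [w /not_implyP [Sw wd]] := unbounded d.
by exists w => //; case: (omega1_total d w) => [?|[|//]]; [left|right].
Qed.

Lemma countable_avoid S :
  countable S -> exists j : nat -> W, injective j /\ forall n, ~ S (j n).
Proof.
move=> S_countable; have /infiniteP/card_leP [j] : infinite_set (~` S).
  move=> /finite_set_countable nS_countable; apply: omega1_uncountable.
  by rewrite -(setUv S); exact: countable_setU.
exists (fun n => val (j (to_setT n))); split=> [m n /val_inj jmn|n];
  last exact: (set_valP (j (to_setT n))).
by have [] : to_setT m = to_setT n by apply: (@inj _ _ _ j) jmn; rewrite inE.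
Qed.

Definition club C := closed_in R C /\ unbounded_in R C.

Lemma closure_points_club (T : W -> set W) w0 : (forall w, countable (T w)) ->
  club [set d | R w0 d /\ forall w, R w d -> T w `<=` below R d].
Proof.
move=> T_countable; split.
  move=> d [x xd] limit; split.
    by have [y [[w0y _] _ yd]] := limit x xd; exact: omega1_trans w0y yd.
  move=> w wd v Twv; have [y [[_ y_closed] wy yd]] := limit w wd.
  exact: omega1_trans (y_closed w wy v Twv) yd.
move=> x.
have /choice [next nextP] u : exists d, forall v,
    ([set u; w0] `|` \bigcup_(w in below R u `|` [set u]) T w) v -> R v d.
  apply: omega1_bounded; apply: countable_setU; first exact: finite_set_countable.
  by apply: bigcup_countable => [|w _];
    [exact: omega1_countable_upto|exact: T_countable].
pose s n := iter n next x.
have s_lt n : R (s n) (s n.+1) by apply: nextP; left; left.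
have [|d [sd least_d]] := @omega1_least [set d | forall n, R (s n) d].
  have [d dP] := omega1_bounded (countable_image s (countableP setT)).
  by exists d => n; apply: dP; exists n.
exists d; split; last exact: (sd 0%N); split.
  by apply: omega1_trans (sd 1%N); apply: nextP; left; right.
move=> w wd v Twv; have /existsNP [n w_sn] := least_d w wd.
apply: omega1_trans (sd n.+1); apply: nextP; right; exists w => //.
by case: (omega1_total w (s n)) => [?|[|//]]; [left|right].
Qed.

End Omega1.

(** * The chain of models *)

Lemma gap_subset (K : structure) (L L' R R' : set K) :
  L `<=` L' -> R `<=` R' -> gap L R -> gap L' R'.
Proof.
move=> LL' RR' [[r Rr] gapLR]; split=> [|z]; first by exists r; exact: RR'.
by have [[l Ll zl]|[r' Rr' rz]] := gapLR z; [left; exists l|right; exists r'];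
  rewrite //; [exact: LL'|exact: RR'].
Qed.

Section Chain.
Variables (W : Type) (R : W -> W -> Prop).
Hypothesis W_omega1 : omega1_order R.
Local Notation labelled := (labelled W).
Implicit Types (A U K : labelled) (c : set W * set W) (S : set W).

Definition label_gap A c := gap (@label W A @^-1` c.1) (@label W A @^-1` c.2).

(* The situation to be destroyed: an isomorphism of the elements below [a] onto those
   below [F a], extended to [[0, a]]. *)
Definition stretching (M : structure) (a : M) (F : M -> M) :=
  [/\ F 0 = 0, nonstandard a, a < F a & ~ E3 a (F a)].

Definition graph_labels A (a : A) (F : A -> A) : set W :=
  [set label (pairing x (F x)) | x in [set x | x <= a]].

Definition cut_labels (U K : labelled) (i : U -> K) (a : U) (F : U -> U) (y : K) :=
  (@label W U @` left_of a (i \o F) y, @label W U @` right_of a (i \o F) y).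

Definition blocks (U K : labelled) (i : U -> K) c (a : U) (F : U -> U) :=
  exists2 y, y < i (F a) & c = cut_labels i a F y.

Lemma graph_labels_inj U a F a' F' : graph_labels a F = graph_labels a' F' :> set W ->
  a = a' /\ forall x : U, x <= a -> F x = F' x.
Proof.
have sub b (G : U -> U) b' G' : graph_labels b G = graph_labels b' G' ->
    forall x, x <= b -> x <= b' /\ G x = G' x.
  move=> E x xb; have : graph_labels b G (label (pairing x (G x))) by exists x.
  by rewrite E => -[x' x'b' /label_inj /pairing_inj [<- <-]].
move=> E; split=> [|x /(sub _ _ _ _ E) []//].
have [aa' _] := sub _ _ _ _ E a (pa_le_refl a).
by have [a'a _] := sub _ _ _ _ (esym E) a' (pa_le_refl a'); pa_lra.
Qed.

Lemma cut_labels_eq (U K : labelled) (i : U -> K) a F F' y :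
  (forall x, x <= a -> F x = F' x) -> cut_labels i a F y = cut_labels i a F' y.
Proof.
move=> FF'; rewrite /cut_labels.
suff [-> ->] : left_of a (i \o F) y = left_of a (i \o F') y /\
  right_of a (i \o F) y = right_of a (i \o F') y by [].
by split; apply/seteqP; split=> x [xa] /=; rewrite /left_of /right_of /= FF'.
Qed.

Lemma label_gap_embedding A U (i : A -> U) c z :
  label_embedding i -> label_gap A c ->
  (exists2 l, c.1 (label l) & i z <= l) \/ (exists2 r, c.2 (label r) & r <= i z).
Proof.
move=> [i_elem i_label] [_ /(_ z) [[l cl zl]|[r cr rz]]].
  by left; exists (i l); rewrite ?i_label // -elementary_le.
by right; exists (i r); rewrite ?i_label // -elementary_le.
Qed.

Lemma extend_labels U (K : structure) (h : U -> K) : countable [set: U] ->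
  countable [set: K] -> injective h ->
  exists l : K -> W, injective l /\ forall x, l (h x) = label x.
Proof.
move=> U_countable /countable_injP [code code_inj] h_inj.
have [j [j_inj j_new]] :=
  countable_avoid W_omega1 (countable_image (@label W U) U_countable).
pose l k := if pselect (exists x, h x = k) is left ex
  then label (sval (cid ex)) else j (code k).
have l_old x : l (h x) = label x.
  rewrite /l; case: pselect => [ex|[]]; last by exists x.
  by case: (cid ex) => y /= /h_inj ->.
have l_new k : ~ (exists x, h x = k) -> l k = j (code k) by rewrite /l; case: pselect.
have l_old_new x k : ~ (exists x, h x = k) -> l (h x) <> l k.
  move=> /l_new ->; rewrite l_old => E.
  by apply: (j_new (code k)); rewrite -E; exists x.
exists l; split=> // k k' kk'; have [[x xk]|new_k] := pselect (exists x, h x = k);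
  have [[x' xk']|new_k'] := pselect (exists x, h x = k').
- by move: kk'; rewrite -xk -xk' !l_old => /label_inj ->.
- by case: (l_old_new x _ new_k'); rewrite xk.
- by case: (l_old_new x' _ new_k); rewrite xk'.
- by move: kk'; rewrite !l_new // => /j_inj /code_inj; apply; rewrite inE.
Qed.

Section LabelledStep.
Variables (U : labelled) (D : set (set W * set W)).
Hypotheses (U_countable : countable [set: U]) (D_countable : countable D).
Hypothesis D_gap : forall c, D c -> label_gap U c.

Let gaps : set (set U * set U) :=
  [set (@label W U @^-1` c.1, @label W U @^-1` c.2) | c in D].

Definition one_step K (i : U -> K) := [/\ countable [set: K], label_embedding i,
  forall c, D c -> label_gap K c & exists y, forall x, y <> i x].

Lemma label_good_extension (M : peano) (h : U -> M) : good_extension gaps h ->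
  exists (l : M -> W) (l_inj : injective l), @one_step (Labelled l_inj) h.
Proof.
move=> [M_countable h_elem h_gaps [y y_new]].
have [l [l_inj l_old]] := extend_labels U_countable M_countable (elementary_inj h_elem).
exists l, l_inj; split=> // [c Dc|]; last by exists y.
have gap_c := h_gaps (@label W U @^-1` c.1, @label W U @^-1` c.2).
by apply: gap_subset (gap_c _) => [_ [x cx <-]|_ [x cx <-]|]; rewrite /= ?l_old //;
  exists c.
Qed.

Lemma labelled_step S : exists (K : labelled) (i : U -> K) c,
  [/\ one_step i, label_gap K c &
      forall a F, stretching a F -> graph_labels a F = S -> blocks i c a F].
Proof.
have gaps_countable : countable gaps by exact: countable_image.
have gaps_gap d : gaps d -> gap d.1 d.2 by move=> [c /D_gap gap_c <-].
have [[a [F [[F0 na a_Fa nE] graphE]]]|none] :=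
    pselect (exists (a : U) F, stretching a F /\ graph_labels a F = S).
  have [M [h [h_good [y [y_lt y_gap]]]]] :=
    separating_extension U_countable gaps_countable gaps_gap F0 na a_Fa nE.
  have [l [l_inj h_step]] := label_good_extension h_good.
  have [_ [_ h_label] _ _] := h_step.
  have {h_label} l_old x : l (h x) = label x := h_label x.
  pose K := Labelled l_inj.
  exists K, h, (@cut_labels U K h a F y); split=> //.
    by apply: gap_subset y_gap => _ [x xP <-]; rewrite /= l_old; exists x.
  move=> a' F' _; rewrite -graphE => /graph_labels_inj [-> F'F]; exists y.
    by rewrite F'F //; exact: pa_le_refl.
  by apply: cut_labels_eq => x /F'F.
have [M [h h_good]] := proper_extension U_countable gaps_countable gaps_gap.
have [l [l_inj h_step]] := label_good_extension h_good.
have [_ [h_elem h_label] _ _] := h_step.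
have {h_label} l_old x : l (h x) = label x := h_label x.
pose K := Labelled l_inj.
exists K, h, (set0, [set label (0 : U)]); split=> //.
  split=> [|z]; first by exists (h 0); rewrite /= l_old.
  by right; exists (h 0); rewrite /= ?l_old // elementary0 //; exact: pa_ge0.
by move=> a F stretch_F graphE; case: none; exists a, F.
Qed.

End LabelledStep.

Variables (base : labelled) (guess : W -> set W).
Hypothesis base_countable : countable [set: base].

Local Notation stage := (labelled * (set W * set W))%type.
Implicit Types (f : W -> stage) (l m : W) (P : set W).

Definition stages f P A := A = base \/ exists m, P m /\ A = (f m).1.

(* The [l]-th stage is a one-step extension of the union of the previous ones; its
   second component is a gap, to be preserved at the later stages. *)
Definition chain_at l f := [/\ countable [set: (f l).1],
  forall m, m = l \/ R m l -> label_gap (f l).1 (f m).2 &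
  exists (U : labelled) (i : U -> (f l).1), [/\ is_union (stages f (below R l)) U,
    label_embedding i, exists y, forall x, y <> i x &
    forall a F, stretching a F -> graph_labels a F = guess l -> blocks i (f l).2 a F]].

Section ChainFacts.
Variables (f : W -> stage) (P : set W).
Hypothesis f_chain : forall m, P m -> chain_at m f.

Lemma embeds_stage m A : P m -> stages f (below R m) A -> embeds A (f m).1.
Proof.
move=> /f_chain [_ _ [U [i [[embeds_U _] i_emb _ _]]]] /embeds_U A_U.
by apply: embeds_trans A_U _; exists i.
Qed.

Lemma embeds_base m : P m -> embeds base (f m).1.
Proof. by move=> Pm; apply: embeds_stage => //; left. Qed.

Lemma embeds_later m l : R m l -> P l -> embeds (f m).1 (f l).1.
Proof. by move=> ml Pl; apply: embeds_stage => //; right; exists m. Qed.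

Lemma embeds_upto m l : m = l \/ R m l -> P l -> embeds (f m).1 (f l).1.
Proof. by move=> [-> _|]; [exact: embeds_refl|exact: embeds_later]. Qed.

Lemma stages_stage m : P m -> stages f P (f m).1.
Proof. by move=> Pm; right; exists m. Qed.

Lemma stages_common m A : P m -> stages f P A ->
  exists l, [/\ P l, m = l \/ R m l & embeds A (f l).1].
Proof.
move=> Pm [->|[n [Pn ->]]]; first by exists m; split; [|left|exact: embeds_base].
have [mn|[mn|nm]] := omega1_total W_omega1 m n.
- by exists n; split; [|right|exact: embeds_refl].
- by exists n; split; [|left|exact: embeds_refl].
- by exists m; split; [|left|exact: embeds_later].
Qed.

Lemma stages_directed : directed (stages f P).
Proof.
move=> A B [->|[m [Pm ->]]] stageB.
  by exists B; split=> //; [|exact: embeds_refl]; case: stageB => [->|[n [Pn ->]]];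
    [exact: embeds_refl|exact: embeds_base].
have [l [Pl ml B_l]] := stages_common Pm stageB.
by exists (f l).1; split=> //; [exact: stages_stage|exact: embeds_upto].
Qed.

Lemma stages_union_ex : exists U, is_union (stages f P) U.
Proof. by apply: (@union_ex _ _ base); [left|exact: stages_directed]. Qed.

Lemma stages_union_gap U m : is_union (stages f P) U -> P m -> label_gap U (f m).2.
Proof.
move=> [embeds_U U_cover] Pm; split.
  have [_ /(_ m (or_introl erefl)) [[r cr] _] _] := f_chain Pm.
  by have [i [_ i_label]] := embeds_U _ (stages_stage Pm); exists (i r);
    rewrite /= i_label.
move=> z; have [A [stageA Az]] := U_cover z.
have [l [Pl ml A_l]] := stages_common Pm stageA.
have [_ /(_ m ml) gap_l _] := f_chain Pl.
have [y _ yz] := embeds_labels A_l Az; have [i i_emb] := embeds_U _ (stages_stage Pl).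
have <- : i y = z by apply: label_inj; rewrite i_emb.2.
exact: label_gap_embedding i_emb gap_l.
Qed.

Lemma stages_union_countable U :
  is_union (stages f P) U -> countable P -> countable [set: U].
Proof.
move=> [_ U_cover] P_countable.
have : countable (labels base `|` \bigcup_(m in P) labels (f m).1).
  apply: countable_setU; first exact: countable_image.
  by apply: bigcup_countable => // m /f_chain [f_countable _ _]; exact: countable_image.
move=> /countable_injP [code code_inj]; apply/countable_injP.
exists (code \o @label W U) => x y _ _ /= /code_inj xy; apply/label_inj/xy; rewrite inE.
  by have [A [[->|[m [Pm ->]]] Ax]] := U_cover x; [left|right; exists m].
by have [A [[->|[m [Pm ->]]] Ay]] := U_cover y; [left|right; exists m].
Qed.

End ChainFacts.

Lemma stages_ext f g P : (forall m, P m -> f m = g m) -> stages f P = stages g P.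
Proof.
move=> fg; apply/funext => A; apply/propext.
by split=> -[->|[m [Pm ->]]]; try (by left); right; exists m; rewrite ?fg // -fg.
Qed.

Lemma chain_at_local l f g :
  (forall m, m = l \/ R m l -> f m = g m) -> chain_at l f -> chain_at l g.
Proof.
move=> fg; rewrite /chain_at (stages_ext (g := g)) => [|m ml]; last by apply: fg; right.
rewrite (fg l); last by left.
by move=> [fl_countable gaps_l U_l]; split=> // m ml; rewrite -(fg m) //; exact: gaps_l.
Qed.

Lemma chain_ex : exists f, forall l, chain_at l f.
Proof.
apply: (@well_founded_choice W stage R chain_at (base, (set0, set0))).
- exact: omega1_wf W_omega1.
- by move=> l f g; exact: chain_at_local.
move=> l f f_chain; have below_countable := omega1_countable_below W_omega1 l.
have [U U_union] := stages_union_ex f_chain.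
have U_countable := stages_union_countable f_chain U_union below_countable.
pose D := [set (f m).2 | m in below R l].
have D_gap c : D c -> label_gap U c.
  by move=> [m ml <-]; exact: (stages_union_gap f_chain U_union ml).
have [K [i [c [[K_countable i_emb K_gap i_new] K_gap_c i_blocks]]]] :=
  labelled_step U_countable (countable_image _ below_countable) D_gap (guess l).
pose g m := if pselect (m = l) then (K, c) else f m.
have gl : g l = (K, c) by rewrite /g; case: pselect.
have gf m : R m l -> g m = f m.
  by rewrite /g; case: pselect => //= {1}-> /(omega1_irrefl W_omega1).
exists g; split=> //; rewrite /chain_at gl /=; split=> //.
  by move=> m [->|ml]; [rewrite gl|rewrite gf //; apply: K_gap; exists m].
by exists U, i; split=> //; rewrite (stages_ext gf).
Qed.

End Chain.

(** * The limit model *)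

Lemma stretching_reflect (K N : structure) (h : K -> N) a F a' F' :
  elementary_embedding h -> h a' = a -> (forall x, h (F' x) = F (h x)) ->
  stretching a F -> stretching a' F'.
Proof.
move=> h_elem a'E F'E [F0 na a_Fa nE]; split.
- by apply: (elementary_inj h_elem); rewrite F'E (elementary0 h_elem).
- by apply: (elementary_nonstandard h_elem); rewrite a'E.
- by apply/(elementary_lt h_elem); rewrite F'E a'E.
- by move=> /(elementary_E3 h_elem); rewrite F'E a'E.
Qed.

Lemma gap_not_onto (K : peano) (a y : K) (F : K -> K) (L R : set K) :
  (forall x x', x < x' -> x' <= a -> F x < F x') ->
  gap L R -> L `<=` left_of a F y -> R `<=` right_of a F y ->
  forall x, x <= a -> F x <> y.
Proof.
move=> /increasing_le F_le [_ gapLR] Ly Ry x xa.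
have [[l /Ly [la Fl] xl]|[r /Ry [ra Fr] rx]] := gapLR x.
  by have := F_le x l xl la => ? ?; pa_lra.
by have := F_le r x rx xa => ? ?; pa_lra.
Qed.

Section Limit.
Variables (W : Type) (R : W -> W -> Prop) (guess : W -> set W).
Hypothesis W_omega1 : omega1_order R.
Hypothesis guess_stationary :
  forall X : set W, stationary R [set d | X `&` below R d = guess d].
Variables (base : labelled W) (f : W -> labelled W * (set W * set W)) (N : labelled W).
Hypothesis f_chain : forall l, chain_at R base guess l f.
Hypothesis N_union : is_union (stages base f setT) N.

Let f_chainT m : setT m -> chain_at R base guess m f := fun _ => f_chain m.

Lemma embeds_limit m : embeds (f m).1 N.
Proof. by apply: N_union.1; exact: stages_stage. Qed.

Lemma limit_labels (x : N) : exists m, labels (f m).1 (label x).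
Proof.
have [A [[->|[m [_ ->]]] Ax]] := N_union.2 x; last by exists m.
by exists (label x); apply: embeds_labels Ax; exact: (embeds_base f_chainT).
Qed.

Lemma stage_new_label l :
  exists2 w, labels (f l).1 w & forall m, R m l -> ~ labels (f m).1 w.
Proof.
have [_ _ [U [i [U_union i_emb [y y_new] _]]]] := f_chain l.
exists (label y); first by exists y.
move=> m ml [x _ xy]; have [j j_emb] := U_union.1 _ (stages_stage base f ml).
by apply: (y_new (j x)); apply: label_inj; rewrite i_emb.2 j_emb.2.
Qed.

Lemma limit_uncountable : ~ countable [set: N].
Proof.
move=> N_countable; apply: (omega1_uncountable W_omega1).
have /choice [x xP] l : exists x : N, labels (f l).1 (label x) /\
    forall m, R m l -> ~ labels (f m).1 (label x).
  have [w [y _ yw] w_new] := stage_new_label l; have [i i_emb] := embeds_limit l.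
  by exists (i y); rewrite i_emb.2; split; [exists y|rewrite yw].
have x_inj : injective x.
  move=> l l' ll'; have [xl l_new] := xP l; have [xl' l'_new] := xP l'.
  have [l_lt|[//|l'_lt]] := omega1_total W_omega1 l l'.
    by case: (l'_new l l_lt); rewrite -ll'.
  by case: (l_new l' l'_lt); rewrite ll'.
have /countable_injP [code code_inj] := N_countable.
by apply/countable_injP; exists (code \o x) => l l' _ _ /code_inj /x_inj; apply;
  rewrite inE.
Qed.

Lemma limit_aleph1 : card_aleph1 N.
Proof.
exists N, (fun x y => R (label x) (label y)); split; last exact: card_eqxx.
split.
- exact: wf_inverse_image (omega1_wf W_omega1).
- by move=> x y z; exact: omega1_trans.
- move=> x y; case: (omega1_total W_omega1 (label x) (label y)) => [|[/label_inj|]];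
    by [left|right; left|right; right].
- exact: limit_uncountable.
move=> x; have /countable_injP [code code_inj] :=
  omega1_countable_below W_omega1 (label x).
apply/countable_injP; exists (code \o @label W N) => y z;
  rewrite !inE => yx zx /code_inj yz.
by apply/label_inj/yz; rewrite inE.
Qed.

Lemma guessed_stage (X : set W) (T : W -> set W) w0 : (forall w, countable (T w)) ->
  exists d, [/\ X `&` below R d = guess d, R w0 d,
    forall w, R w d -> T w `<=` below R d &
    forall U, is_union (stages base f (below R d)) U ->
      forall x : N, labels U (label x) <-> R (label x) d].
Proof.
move=> T_countable.
have /choice [stage_of stage_ofP] w : exists m, labels N w -> labels (f m).1 w.
  have [[x _ <-]|nNw] := pselect (labels N w); last by exists w.
  by have [m mx] := limit_labels x; exists m.
pose T' w := T w `|` (labels (f w).1 `|` [set stage_of w]).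
have T'_countable w : countable (T' w).
  apply: countable_setU => //; apply: countable_setU; last exact: countable1.
  by apply: countable_image; have [f_countable _ _] := f_chain w.
have [C_closed C_unbounded] := closure_points_club W_omega1 w0 T'_countable.
have [d [dX [w0d d_closed]]] := guess_stationary X C_closed C_unbounded.
exists d; split=> // [w wd v Twv|U [embeds_U U_cover] x].
  by apply: (d_closed w wd); left.
split=> [[u _ ux]|xd].
  have [A [[->|[m [md ->]]] Au]] := U_cover u; last first.
    by apply: (d_closed m) => //; right; left; rewrite -ux.
  apply: (d_closed w0) => //; right; left; rewrite -ux.
  by apply: embeds_labels Au; exact: (embeds_base f_chainT).
have /stage_ofP mx : labels N (label x) by exists x.
apply: embeds_labels mx; apply/embeds_U/stages_stage.
by apply: (d_closed (label x)) => //; right; right.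
Qed.

Lemma blocked_stage (a : N) (F : N -> N) : stretching a F ->
  exists d (U : labelled W) (i : U -> (f d).1) (j : (f d).1 -> N) a' F',
  [/\ label_embedding i, label_embedding j, j (i a') = a,
      forall u, j (i (F' u)) = F (j (i u)) & blocks i (f d).2 a' F'].
Proof.
move=> stretch_F.
have /choice [image_label image_labelP] w :
  exists v, forall x : N, label x = w -> v = label (F x).
  have [[x xw]|none] := pselect (exists x : N, label x = w); last first.
    by exists w => x xw; case: none; exists x.
  by exists (label (F x)) => x'; rewrite -xw => /label_inj ->.
have /choice [fst_label fst_labelP] w :
    exists v, forall x : N, label (pairing x (F x)) = w -> v = label x.
  have [[x xw]|none] := pselect (exists x : N, label (pairing x (F x)) = w); last first.
    by exists w => x xw; case: none; exists x.
  by exists (label x) => x'; rewrite -xw => /label_inj /pairing_inj [->].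
have [|d [dX ad d_closed U_below]] := @guessed_stage (graph_labels a F)
    (fun w => [set image_label w; fst_label w]) (label a).
  by move=> w; exact: finite_set_countable.
have [_ _ [U [i [U_union i_emb _ i_blocks]]]] := f_chain d.
have [j j_emb] := embeds_limit d; pose k := j \o i.
have k_emb : label_embedding k := label_embedding_comp i_emb j_emb.
have below_U x : R (label x) d -> exists u, k u = x.
  move=> /(U_below U U_union) [u _ ux]; exists u.
  by apply: label_inj; rewrite k_emb.2.
have U_lt u : R (label (k u)) d.
  by apply/(U_below U U_union); exists u => //; rewrite k_emb.2.
have [a' a'E] := below_U a ad.
have /choice [F' F'E] u : exists v, k v = F (k u).
  apply: below_U; apply: (d_closed _ (U_lt u)).
  by left; exact: esym (image_labelP _ _ erefl).
have pairE u : label (pairing u (F' u)) = label (pairing (k u) (F (k u))).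
  by rewrite -F'E -(elementary_pairing k_emb.1) k_emb.2.
exists d, U, i, j, a', F'; split=> //; apply: i_blocks.
  exact: stretching_reflect k_emb.1 a'E F'E stretch_F.
rewrite -dX; apply/seteqP; split=> [_ [u ua' <-]|_ [[x xa <-] xd]].
  split; last by have := U_lt (pairing u (F' u)); rewrite k_emb.2.
  by exists (k u); rewrite ?pairE //= -a'E -(elementary_le u a' k_emb.1).
have [|u ux] := below_U x.
  by apply: (d_closed _ xd); right; exact: esym (fst_labelP _ _ erefl).
exists u; last by rewrite pairE ux.
by rewrite /= (elementary_le u a' k_emb.1) ux a'E.
Qed.

Lemma stretching_not_onto (a : N) F : stretching a F ->
  (forall x x', x < x' -> x' <= a -> F x < F x') ->
  exists2 y, y < F a & forall x, x <= a -> F x <> y.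
Proof.
move=> /blocked_stage [d [U [i [j [a' [F' [i_emb j_emb a'E F'E [y y_lt cutE]]]]]]]]
  F_mono.
have ji_emb := label_embedding_comp i_emb j_emb.
exists (j y); first by rewrite -a'E -F'E -elementary_lt //; exact: j_emb.1.
have := stages_union_gap W_omega1 f_chainT N_union (I : setT d).
rewrite cutE => gap_N.
have jiE u x : label u = label x -> j (i u) = x.
  by move=> ux; apply: label_inj; rewrite (ji_emb.2 u).
have ji_le u : u <= a' -> j (i u) <= a by rewrite -a'E (elementary_le u a' ji_emb.1).
apply: (gap_not_onto F_mono gap_N) => x [u [/ji_le xa uy] /jiE ux].
  by rewrite -ux; split=> //; rewrite -F'E -(elementary_lt j_emb.1).
by rewrite -ux; split=> //; rewrite -F'E -(elementary_lt j_emb.1).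
Qed.

Lemma limit_rigid_lt (a b : N) g : nonstandard a -> a < b ->
  order_iso (below (@lt N) a) (below (@lt N) b) g -> E3 a b.
Proof.
move=> na ab /(order_iso_below_extension (na 0%N)) [F [F0 Fa F_mono F_onto]].
apply: contrapT => nE; have [|y yb y_new] := @stretching_not_onto a F _ F_mono.
  by split; rewrite ?Fa.
by rewrite Fa in yb; have [x xa /(y_new x xa)] := F_onto y yb.
Qed.

Lemma limit_rigid : order_rigid3 N.
Proof.
move=> a b /nonstandardP na /nonstandardP nb [g g_iso].
have [<-|/pa_neq_lt [ab|ba]] := pselect (a = b); first exact: E3_refl.
  exact: limit_rigid_lt g_iso.
by have [g' g'_iso] := order_iso_inverse g_iso; apply: E3_sym;
  exact: limit_rigid_lt g'_iso.
Qed.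

End Limit.

Theorem theorem3p9 (M : structure) :
  diamond_aleph1 ->
  PA_model M -> ordinary M -> countable [set: M] ->
  exists (N : structure) (h : M -> N),
    [/\ elementary_embedding h,
        PA_model N /\ ordinary N,
        card_aleph1 N,
        (forall a b : N, ~ standard a -> ~ standard b -> (E5 a b <-> E3 a b)) &
        order_rigid3 N].
Proof.
move=> [W [R [W_omega1 [guess [_ guess_stationary]]]]] M_PA _ M_countable.
have [j [j_inj _]] := countable_avoid W_omega1 (@countable0 W).
have /countable_injP [code code_inj] := M_countable.
have label_inj : injective (j \o code : Peano M_PA -> W).
  by move=> x y /= /j_inj /code_inj; apply; rewrite inE.
pose base := Labelled label_inj.
have [f f_chain] := chain_ex W_omega1 (base := base) guess M_countable.
have [N N_union] := stages_union_ex W_omega1 (fun m (_ : setT m) => f_chain m).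
have N_rigid := limit_rigid W_omega1 guess_stationary f_chain N_union.
have [h [h_elem _]] : embeds base N by apply: N_union.1; left.
exists N, h; split=> //.
- by split; [exact: peano_axioms|exact: peano_ordinary].
- exact: (limit_aleph1 W_omega1 f_chain N_union).
- move=> a b a_nstd b_nstd; split=> [/E5_order_iso_below|]; first exact: N_rigid.
  exact: E3_E5.
Qed.
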